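(* For all $q\in (1,\infty)$, with $q^*=q/(q-1)$, $$\int_0^{\infty} \left|\frac{\sin_{q^*,q}{x}}{x}\right|^{q}\,dx=\frac{q^*}{2^{2/q}}\int_0^{\infty} \left|\frac{\sin_{2,q}{x}}{x}\right|^{q-2}\frac{\sin_{2,q}{x}}{x}\,dx.$$ Hence, when $q$ is an even integer, $$\int_0^{\infty} \left(\frac{\sin_{q^*,q}{x}}{x}\right)^{q}\,dx=\frac{q^*}{2^{2/q}}\int_0^{\infty} \left(\frac{\sin_{2,q}{x}}{x}\right)^{q-1}\,dx;$$ in particular, when $q=2$, $$\int_0^{\infty} \left(\frac{\sin{x}}{x}\right)^2\,dx=\int_0^{\infty} \frac{\sin{x}}{x}\,dx.$$
   Context: For $p,q\in(1,\infty)$ let $F_{p,q}(x)=\int_0^x (1-t^q)^{-1/p}\,dt$ for $x\in[0,1]$, and let $\pi_{p,q}:=2F_{p,q}(1)$. The generalised sine function $\sin_{p,q}:[0,\pi_{p,q}/2]\to[0,1]$ is the inverse of $F_{p,q}:[0,1]\to[0,\pi_{p,q}/2]$. It is extended to all of $\mathbb{R}$ as a $2\pi_{p,q}$-periodic function by $\sin_{p,q}x=\sin_{p,q}(\pi_{p,q}-x)$ and $\sin_{p,q}(-x)=-\sin_{p,q}x$. For $p=q=2$ this is the usual sine. The function $(\sin_{p,q}x)/x$ is given the value $1$ at $x=0$, and $|s|^{q-2}s$ is read as $0$ when $s=0$. Integrals over $[0,\infty)$ are improper Riemann integrals, i.e. $\int_0^\infty=\lim_{R\to\infty}\int_0^R$.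 *)

(* Defs.v *)
From Stdlib Require Import Reals.
From Coquelicot Require Import Coquelicot.
Open Scope R_scope.

(* [x ^ y] for a base [x >= 0], with [0 ^ y = 0].  Plain [Rpower] satisfies
   [Rpower 0 y = 1]. *)
Definition rpow (x y : R) : R :=
  if Rlt_dec 0 x then Rpower x y else 0.

Definition conj_exp (q : R) : R := q / (q - 1).

Definition F_integrand (p q t : R) : R := rpow (1 - rpow t q) (- / p).

(* The integrand is unbounded at [t = 1], so [Fpq p q 1] has to be an improper
   integral. *)
Definition Fpq (p q x : R) : R :=
  if Rlt_dec x 1 then RInt (F_integrand p q) 0 x
  else RInt_gen (F_integrand p q) (at_point 0) (at_left 1).

Definition pi_pq (p q : R) : R := 2 * Fpq p q 1.

(* Meaningful for [y] in [[0, pi_pq p q / 2]]: [iota] selects the unique [x]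
   satisfying the predicate. *)
Definition sin_pq_base (p q y : R) : R :=
  iota (fun x : R => 0 <= x <= 1 /\ Fpq p q x = y).

Definition sin_pq_half (p q y : R) : R :=
  if Rle_dec y (pi_pq p q / 2) then sin_pq_base p q y
  else sin_pq_base p q (pi_pq p q - y).

Definition sin_pq_period (p q y : R) : R :=
  if Rle_dec 0 y then sin_pq_half p q y else - sin_pq_half p q (- y).

(* The argument is translated by a multiple of [2 * pi_pq p q] into
   [[- pi_pq p q, pi_pq p q)]. *)
Definition sin_pq (p q x : R) : R :=
  let T := 2 * pi_pq p q in
  sin_pq_period p q (x - IZR (Int_part ((x + pi_pq p q) / T)) * T).

Definition over_id (s : R -> R) (x : R) : R :=
  if Req_dec_T x 0 then 1 else s x / x.

(* Improper Riemann integrals, the limit of [RInt f 0 M] as [M] tends to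
   infinity; convergence may be conditional. *)
Definition ex_RInt_0_oo (f : R -> R) : Prop :=
  ex_RInt_gen f (at_point 0) (Rbar_locally p_infty).

Definition RInt_0_oo (f : R -> R) : R :=
  RInt_gen f (at_point 0) (Rbar_locally p_infty).

(* [RInt_0_oo] is total, so the equality of integrals is stated together with
   the convergence of both. *)
Definition integrals_eq (f : R -> R) (c : R) (g : R -> R) : Prop :=
  ex_RInt_0_oo f /\ ex_RInt_0_oo g /\ RInt_0_oo f = c * RInt_0_oo g.

(* Main.v *)
Require Import Defs.
From Stdlib Require Import Reals Arith Lra Lia Classical FunctionalExtensionality.
From Coquelicot Require Import Coquelicot.
Open Scope R_scope.

(** Write [S] for the sine with conjugate exponents [q* , q], [s] for the sine with exponents
    [2, q], and [k = 2 ^ (2 / q)].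

    The reason for the identity is a double-angle formula. For conjugate exponents the
    curve [u ^ q + v ^ q = 1] is symmetric for the arc-length-like integral [F] that [S]
    inverts: [F u + F v] is constant on it ([F_duality]). Hence [T x = S (x + quarter)]
    satisfies [|S| ^ q + |T| ^ q = 1] and [S' = |T| ^ (q - 2) T] ([cosine_dual],
    [derive_sin_conj]). With [a = u ^ q], the point [w = k u v] satisfies
    [1 - w ^ q = 1 - 4 a (1 - a) = (1 - 2 a) ^ 2], a perfect square, which is what the
    exponent [- 1 / 2] in the integral for [s] asks for; comparing derivatives gives
    [s (k x) = k S x T x] ([sin_2q_double]). For [q = 2] this is
    [sin (2 x) = 2 sin x cos x].

    Integrating [|S x| ^ q x ^ (- q)] by parts produces [q*] times the integral of
    [|S| ^ (q - 2) S S' x ^ (1 - q)], whose integrand is the signed power of exponent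
    [q - 1] of [S x T x / x], that is, of [s (k x) / (k x)]. The substitution [y = k x] then
    yields the factor [q* / k] ([integration_by_parts]). The left integral converges by
    comparison with [x ^ (- q)] and the boundary term tends to [0], so the right integral,
    which may converge only conditionally, converges as well ([lhs_rhs_limits]).

    The improper integrals defining the two half periods converge without any estimate of
    their own: duality exchanges the singular end of [F] with its regular end
    ([F_limit_conj]), and the double-angle formula carries the limit over to [s]
    ([F2_limit]). *)

(** * Calculus preliminaries *)

Lemma is_derive_eq (f : R -> R) (x l l' : R) :
  is_derive f x l -> l = l' -> is_derive f x l'.
Proof. now intros H <-. Qed.

Lemma is_derive_continuous (f : R -> R) (x l : R) :
  is_derive f x l -> continuous f x.
Proof. intros H; apply (ex_derive_continuous f x); now exists l. Qed.

Lemma derive_comp (f g : R -> R) (x df dg : R) :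
  is_derive f (g x) df -> is_derive g x dg ->
  is_derive (fun y => f (g y)) x (df * dg).
Proof.
  intros Hf Hg; eapply is_derive_eq; [exact (is_derive_comp f g x df dg Hf Hg)|].
  apply Rmult_comm.
Qed.

Lemma derive_mult (f g : R -> R) (x df dg : R) :
  is_derive f x df -> is_derive g x dg ->
  is_derive (fun y => f y * g y) x (df * g x + f x * dg).
Proof. intros Hf Hg; exact (is_derive_mult f g x df dg Hf Hg Rmult_comm). Qed.

Lemma derive_plus (f g : R -> R) (x df dg : R) :
  is_derive f x df -> is_derive g x dg ->
  is_derive (fun y => f y + g y) x (df + dg).
Proof. intros Hf Hg; exact (is_derive_plus f g x df dg Hf Hg). Qed.

Lemma derive_minus (f g : R -> R) (x df dg : R) :
  is_derive f x df -> is_derive g x dg ->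
  is_derive (fun y => f y - g y) x (df - dg).
Proof. intros Hf Hg; exact (is_derive_minus f g x df dg Hf Hg). Qed.

Lemma derive_opp (f : R -> R) (x df : R) :
  is_derive f x df -> is_derive (fun y => - f y) x (- df).
Proof. intros H; exact (is_derive_opp f x df H). Qed.

Lemma derive_reflect (f : R -> R) (x df : R) :
  is_derive f (- x) df -> is_derive (fun y => f (- y)) x (- df).
Proof.
  intros H; eapply is_derive_eq.
  - apply (derive_comp f Ropp x df (-1) H). auto_derive; [exact I|ring].
  - ring.
Qed.

Lemma derive_shift (f : R -> R) (x a df : R) :
  is_derive f (x + a) df -> is_derive (fun y => f (y + a)) x df.
Proof.
  intros H; eapply is_derive_eq.
  - apply (derive_comp f (fun y => y + a) x df 1 H). auto_derive; [exact I|ring].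
  - ring.
Qed.

Lemma periodic_ind (Q : R -> Prop) (a L : R) :
  0 < L -> (forall x, Q x <-> Q (x + L)) -> (forall x, a <= x < a + L -> Q x) ->
  forall x, Q x.
Proof.
  intros HL Hper Hfund x.
  assert (Hn : forall (n : Z) y, Q y <-> Q (y + IZR n * L)).
  { intros n y. induction n as [|n IH|n IH] using Z.peano_ind.
    - now rewrite Rmult_0_l, Rplus_0_r.
    - rewrite IH, succ_IZR, Hper.
      now replace (y + (IZR n + 1) * L) with (y + IZR n * L + L) by ring.
    - unfold Z.pred. rewrite IH, plus_IZR, (Hper (y + (IZR n + -1) * L)).
      now replace (y + (IZR n + -1) * L + L) with (y + IZR n * L) by ring. }
  destruct (base_Int_part ((x - a) / L)) as [H1 H2].
  apply (Hn (- Int_part ((x - a) / L))%Z), Hfund. rewrite opp_IZR.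
  set (n := IZR (Int_part ((x - a) / L))) in *.
  assert (E : (x - a) / L * L = x - a) by (field; lra).
  assert (H3 := Rmult_le_compat_r L _ _ (Rlt_le _ _ HL) H1).
  assert (H4 : (x - a) / L < n + 1) by lra.
  assert (H5 := Rmult_lt_compat_r L _ _ HL H4).
  lra.
Qed.

Lemma derive_id_mult_0 (f : R -> R) :
  continuous f 0 -> is_derive (fun x => x * f x) 0 (f 0).
Proof.
  intros Hc. apply is_derive_Reals. intros eps Heps.
  destruct (proj1 (filterlim_locally f (f 0)) Hc (mkposreal eps Heps)) as [d Hd].
  exists d. intros h Hh Hhd.
  replace ((_ - _) / h - f 0) with (f h - f 0) by (rewrite Rplus_0_l; now field).
  apply (Hd h). change (Rabs (h - 0) < d). now rewrite Rminus_0_r.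
Qed.

Lemma continuous_over_id (s : R -> R) :
  s 0 = 0 -> is_derive s 0 1 -> (forall x, continuous s x) ->
  forall x, continuous (over_id s) x.
Proof.
  intros Hs0 Hs Hc x. destruct (Req_dec_T x 0) as [->|Hx].
  - apply filterlim_locally. intros eps.
    apply is_derive_Reals in Hs. destruct (Hs eps (cond_pos eps)) as [d Hd].
    exists d. intros y Hy. change (Rabs (y - 0) < d) in Hy.
    rewrite Rminus_0_r in Hy.
    change (Rabs (over_id s y - over_id s 0) < eps).
    unfold over_id. destruct (Req_dec_T 0 0) as [_|]; [|lra].
    destruct (Req_dec_T y 0) as [_|Hy0].
    + rewrite Rminus_eq_0, Rabs_R0. apply cond_pos.
    + specialize (Hd y Hy0 Hy). now rewrite Hs0, Rplus_0_l, Rminus_0_r in Hd.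
  - apply continuous_ext_loc with (fun y => s y * / y).
    + exists (mkposreal _ (Rabs_pos_lt x Hx)). intros y Hy.
      change (Rabs (y - x) < Rabs x) in Hy.
      unfold over_id. destruct (Req_dec_T y 0) as [->|_]; [|reflexivity].
      rewrite Rminus_0_l, Rabs_Ropp in Hy. lra.
    + apply (continuous_mult s (fun y => / y)); [apply Hc|].
      now apply continuous_Rinv.
Qed.

(** Carathéodory's argument: the slope of [g] between [y] and [t] is the inverse of the slope
    of [f] between [g y] and [g t], and continuity of [g] brings these two points together. *)
Lemma derive_inverse (f g : R -> R) (y d : R) :
  locally y (fun t => f (g t) = t) -> continuous g y ->
  is_derive f (g y) d -> d <> 0 -> is_derive g y (/ d).
Proof.
  intros Hfg Hg Hf Hd.
  assert (Hslope : continuous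
    (fun u => if Req_dec_T u (g y) then / d else / ((f u - f (g y)) / (u - g y)))
    (g y)).
  { apply is_derive_Reals in Hf.
    apply continuous_ext with
      (fun u => / (if Req_dec_T u (g y) then d else (f u - f (g y)) / (u - g y))).
    { intros u. now destruct Req_dec_T. }
    apply continuous_Rinv_comp; [|now destruct Req_dec_T].
    apply filterlim_locally. intros eps.
    destruct (Hf eps (cond_pos eps)) as [del Hdel]. exists del. intros u Hu.
    change (Rabs (u - g y) < del) in Hu.
    match goal with |- ball ?a _ ?b => change (Rabs (b - a) < eps) end.
    destruct (Req_dec_T (g y) (g y)) as [_|]; [|lra].
    destruct (Req_dec_T u (g y)) as [_|Hu0].
    - rewrite Rminus_eq_0, Rabs_R0. apply cond_pos.
    - specialize (Hdel (u - g y)). rewrite Rplus_minus in Hdel.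
      apply Hdel; [now apply Rminus_eq_contra|assumption]. }
  assert (Hc := continuous_comp g _ y Hg Hslope). cbv beta in Hc.
  apply is_derive_Reals. intros eps Heps.
  destruct (proj1 (filterlim_locally _ _) Hc (mkposreal eps Heps)) as [d1 Hd1].
  destruct Hfg as [d2 Hd2].
  assert (Hy : f (g y) = y) by (apply Hd2; apply ball_center).
  exists (mkposreal _ (Rmin_stable_in_posreal d1 d2)). intros h Hh Hhd. simpl in Hhd.
  assert (Hb : forall e : posreal, Rabs h < e -> ball y e (y + h)).
  { intros e He. change (Rabs (y + h - y) < e). now replace (y + h - y) with h by ring. }
  assert (Hyh : f (g (y + h)) = y + h).
  { apply Hd2, Hb. apply Rlt_le_trans with (1 := Hhd), Rmin_r. }
  assert (H := Hd1 (y + h) (Hb d1 (Rlt_le_trans _ _ _ Hhd (Rmin_l _ _)))).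
  match type of H with ball ?a _ ?b => change (Rabs (b - a) < eps) in H end.
  destruct (Req_dec_T (g y) (g y)) as [_|]; [|lra].
  destruct (Req_dec_T (g (y + h)) (g y)) as [E|E].
  - rewrite E, Hy in Hyh. lra.
  - rewrite Hyh, Hy in H.
    replace ((g (y + h) - g y) / h) with (/ ((y + h - y) / (g (y + h) - g y))); [exact H|].
    field. split; [assumption|now apply Rminus_eq_contra].
Qed.

Lemma monotone_limit (J : R -> R) (B : R) :
  (forall x y, 0 <= x <= y -> J x <= J y) -> (forall x, 0 <= x -> J x <= B) ->
  exists L : R, filterlim J (Rbar_locally p_infty) (locally L).
Proof.
  intros Hincr HB.
  destruct (completeness (fun v => exists x, 0 <= x /\ v = J x)) as [L [HL1 HL2]].
  - exists B. intros v [x [Hx ->]]. now apply HB.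
  - exists (J 0), 0. split; [apply Rle_refl|reflexivity].
  - exists L. apply filterlim_locally. intros eps.
    assert (Hex : exists x0, 0 <= x0 /\ L - eps < J x0).
    { apply NNPP. intros Hno. assert (H : L <= L - eps).
      { apply HL2. intros v [x [Hx ->]]. destruct (Rle_lt_dec (J x) (L - eps)) as [H|H];
          [exact H|]. elim Hno. now exists x. }
      assert (He := cond_pos eps). lra. }
    destruct Hex as [x0 [Hx0 Hlt]]. exists x0. intros x Hx.
    change (Rabs (J x - L) < eps). assert (He := cond_pos eps).
    assert (H1 := Hincr x0 x ltac:(lra)).
    assert (H2 := HL1 (J x) ltac:(exists x; split; [lra|reflexivity])).
    apply Rabs_def1; lra.
Qed.

Lemma derive_RInt (f : R -> R) (x : R) :
  (forall y, continuous f y) -> is_derive (fun b => RInt f 0 b) x (f x).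
Proof.
  intros Hf. apply (is_derive_RInt f (fun b => RInt f 0 b) 0); [|apply Hf].
  apply filter_forall. intros b. apply (RInt_correct (V := R_CompleteNormedModule)).
  apply (ex_RInt_continuous (V := R_CompleteNormedModule)). intros z _. apply Hf.
Qed.

Lemma RInt_nonneg_incr (f : R -> R) (x y : R) :
  (forall z, continuous f z) -> (forall z, 0 <= f z) -> x <= y ->
  RInt f 0 x <= RInt f 0 y.
Proof.
  intros Hc Hf Hxy.
  destruct (MVT_gen (fun b => RInt f 0 b) x y f) as [c [_ E]].
  - intros t _. now apply derive_RInt.
  - intros t _. apply continuity_pt_filterlim.
    apply (is_derive_continuous (fun b => RInt f 0 b) t (f t)). now apply derive_RInt.
  - assert (H := Rmult_le_pos (f c) (y - x) (Hf c)). lra.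
Qed.

Lemma is_RInt_gen_of_lim (f : R -> R) (a l : R) (G : (R -> Prop) -> Prop) :
  Filter G -> G (fun b => ex_RInt f a b) ->
  filterlim (fun b => RInt f a b) G (locally l) ->
  is_RInt_gen f (at_point a) G l.
Proof.
  intros HG Hex Hlim P HP.
  apply Filter_prod with (fun x => x = a) (fun b => ex_RInt f a b /\ P (RInt f a b)).
  - reflexivity.
  - apply filter_and; [exact Hex|exact (Hlim P HP)].
  - intros x b -> [Hb Hp]. exists (RInt f a b). split; [exact (RInt_correct f a b Hb)|exact Hp].
Qed.

Lemma integrals_eq_of_limits (f g : R -> R) (c Lf Lg : R) :
  (forall x, continuous f x) -> (forall x, continuous g x) ->
  filterlim (fun M => RInt f 0 M) (Rbar_locally p_infty) (locally Lf) ->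
  filterlim (fun M => RInt g 0 M) (Rbar_locally p_infty) (locally Lg) ->
  Lf = c * Lg -> integrals_eq f c g.
Proof.
  intros Hf Hg HLf HLg E.
  assert (Hgen : forall (h : R -> R) L, (forall x, continuous h x) ->
    filterlim (fun M => RInt h 0 M) (Rbar_locally p_infty) (locally L) ->
    is_RInt_gen h (at_point 0) (Rbar_locally p_infty) L).
  { intros h L Hh HL. apply is_RInt_gen_of_lim; [typeclasses eauto| |exact HL].
    apply filter_forall. intros b. apply (ex_RInt_continuous (V := R_CompleteNormedModule)).
    intros z _. apply Hh. }
  assert (Hval : forall (h : R -> R) L,
    is_RInt_gen h (at_point 0) (Rbar_locally p_infty) L -> RInt_0_oo h = L).
  { intros h L HL.
    exact (is_RInt_gen_unique (FFa := Proper_StrongProper _ _)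
      (FFb := Proper_StrongProper _ _) h L HL). }
  specialize (Hgen f Lf Hf HLf) as Gf. specialize (Hgen g Lg Hg HLg) as Gg.
  split; [|split].
  - now exists Lf.
  - now exists Lg.
  - rewrite (Hval f Lf Gf), (Hval g Lg Gg). exact E.
Qed.

(** * Powers extended by zero *)

Lemma rpow_pos (x a : R) : 0 < x -> rpow x a = Rpower x a.
Proof. unfold rpow. destruct (Rlt_dec 0 x); [reflexivity|lra]. Qed.

Lemma rpow_nonpos (x a : R) : x <= 0 -> rpow x a = 0.
Proof. unfold rpow. destruct (Rlt_dec 0 x); [lra|reflexivity]. Qed.

Lemma rpow_gt0 (x a : R) : 0 < x -> 0 < rpow x a.
Proof. intros H. rewrite rpow_pos by assumption. apply exp_pos. Qed.

Lemma rpow_ge0 (x a : R) : 0 <= rpow x a.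
Proof.
  destruct (Rlt_le_dec 0 x) as [H|H].
  - now apply Rlt_le, rpow_gt0.
  - rewrite rpow_nonpos by assumption. lra.
Qed.

Lemma rpow_base1 (a : R) : rpow 1 a = 1.
Proof.
  rewrite rpow_pos by lra. unfold Rpower. now rewrite ln_1, Rmult_0_r, exp_0.
Qed.

Lemma rpow_1 (x : R) : 0 <= x -> rpow x 1 = x.
Proof.
  intros [H|<-].
  - rewrite rpow_pos by assumption. now apply Rpower_1.
  - apply rpow_nonpos; lra.
Qed.

Lemma rpow_plus (x a b : R) : rpow x (a + b) = rpow x a * rpow x b.
Proof.
  destruct (Rlt_le_dec 0 x) as [H|H].
  - rewrite !rpow_pos by assumption. apply Rpower_plus.
  - rewrite !rpow_nonpos by assumption. ring.
Qed.

Lemma rpow_rpow (x a b : R) : rpow (rpow x a) b = rpow x (a * b).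
Proof.
  destruct (Rlt_le_dec 0 x) as [H|H].
  - rewrite (rpow_pos (rpow x a)) by now apply rpow_gt0.
    rewrite !rpow_pos by assumption. apply Rpower_mult.
  - rewrite (rpow_nonpos x a), !rpow_nonpos; lra.
Qed.

Lemma rpow_mult_base (x y a : R) :
  0 <= x -> 0 <= y -> rpow (x * y) a = rpow x a * rpow y a.
Proof.
  intros [Hx|<-] [Hy|<-].
  2-4: rewrite ?Rmult_0_l, ?Rmult_0_r, !(rpow_nonpos 0) by lra; ring.
  rewrite !rpow_pos; try assumption.
  - symmetry. now apply Rpower_mult_distr.
  - now apply Rmult_lt_0_compat.
Qed.

Lemma rpow_inv (x a b : R) : 0 <= x -> a * b = 1 -> rpow (rpow x a) b = x.
Proof. intros Hx E. rewrite rpow_rpow, E. now apply rpow_1. Qed.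

Lemma rpow_Rinv (x a : R) : 0 < x -> rpow (/ x) a = rpow x (- a).
Proof.
  intros Hx. replace (/ x) with (rpow x (- (1))).
  - rewrite rpow_rpow. f_equal. ring.
  - now rewrite rpow_pos, Rpower_Ropp, Rpower_1.
Qed.

Lemma rpow_lt (x y a : R) : 0 < a -> 0 <= x < y -> rpow x a < rpow y a.
Proof.
  intros Ha [[Hx|<-] Hy].
  - rewrite !rpow_pos by lra. now apply Rlt_Rpower_l.
  - rewrite rpow_nonpos by lra. now apply rpow_gt0.
Qed.

Lemma rpow_le (x y a : R) : 0 < a -> 0 <= x <= y -> rpow x a <= rpow y a.
Proof.
  intros Ha [Hx [Hy|<-]].
  - now apply Rlt_le, rpow_lt.
  - apply Rle_refl.
Qed.

Lemma rpow_lt1 (x a : R) : 0 < a -> x < 1 -> rpow x a < 1.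
Proof.
  intros Ha Hx. destruct (Rle_lt_dec x 0) as [H|H].
  - rewrite rpow_nonpos; lra.
  - rewrite <- (rpow_base1 a). apply rpow_lt; lra.
Qed.

Lemma rpow_le1 (x a : R) : 0 < a -> x <= 1 -> rpow x a <= 1.
Proof.
  intros Ha [Hx| ->].
  - now apply Rlt_le, rpow_lt1.
  - rewrite rpow_base1. lra.
Qed.

Lemma rpow_INR (x : R) (n : nat) : (0 < n)%nat -> 0 <= x -> rpow x (INR n) = x ^ n.
Proof.
  intros Hn [Hx|<-].
  - rewrite rpow_pos by assumption. now apply Rpower_pow.
  - rewrite rpow_nonpos, pow_i; [reflexivity|assumption|lra].
Qed.

Lemma derive_rpow_pos (x a : R) :
  0 < x -> is_derive (fun y => rpow y a) x (a * rpow x (a - 1)).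
Proof.
  intros Hx. apply is_derive_ext_loc with (fun y => Rpower y a).
  - exists (mkposreal x Hx). intros y Hy. change (Rabs (y - x) < x) in Hy.
    apply Rabs_def2 in Hy. rewrite rpow_pos; [reflexivity|lra].
  - rewrite rpow_pos by assumption. now apply is_derive_Reals, derivable_pt_lim_power.
Qed.

Lemma derive_rpow_neg (x a : R) : x < 0 -> is_derive (fun y => rpow y a) x 0.
Proof.
  intros Hx. assert (Hx' : 0 < - x) by lra.
  apply is_derive_ext_loc with (fun _ => 0).
  - exists (mkposreal _ Hx'). intros y Hy. change (Rabs (y - x) < - x) in Hy.
    apply Rabs_def2 in Hy. rewrite rpow_nonpos; [reflexivity|lra].
  - apply (is_derive_const (K := R_AbsRing) (V := R_NormedModule)).
Qed.

Lemma continuous_rpow (x a : R) : 0 < a -> continuous (fun y => rpow y a) x.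
Proof.
  intros Ha. destruct (Rtotal_order x 0) as [H|[->|H]].
  - eapply is_derive_continuous. now apply derive_rpow_neg.
  - apply filterlim_locally. intros eps.
    exists (mkposreal _ (rpow_gt0 eps (/ a) (cond_pos eps))). intros y Hy.
    change (Rabs (y - 0) < rpow eps (/ a)) in Hy.
    change (Rabs (rpow y a - rpow 0 a) < eps).
    rewrite (rpow_nonpos 0), Rminus_0_r in * by lra.
    rewrite Rabs_right by apply Rle_ge, rpow_ge0.
    destruct (Rle_lt_dec y 0) as [H|H].
    + rewrite rpow_nonpos by assumption. apply cond_pos.
    + rewrite Rabs_right in Hy by lra.
      rewrite <- (rpow_inv eps (/ a) a) by
        (try apply Rlt_le, cond_pos; field; lra).
      apply rpow_lt; lra.
  - eapply is_derive_continuous. now apply derive_rpow_pos.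
Qed.

Lemma rpow_pred (x a : R) : rpow x a = x * rpow x (a - 1).
Proof.
  destruct (Rlt_le_dec 0 x) as [H|H].
  - rewrite <- (rpow_1 x) at 2 by lra. rewrite <- rpow_plus. f_equal; ring.
  - rewrite !rpow_nonpos by assumption. ring.
Qed.

(** Beyond the power rule on [x > 0], this covers the junction at [0], where
    [rpow x a = x * rpow x (a - 1)] exhibits the slope. *)
Lemma derive_rpow (x a : R) :
  1 < a -> is_derive (fun y => rpow y a) x (a * rpow x (a - 1)).
Proof.
  intros Ha. destruct (Rtotal_order x 0) as [H|[->|H]].
  - eapply is_derive_eq; [now apply derive_rpow_neg|].
    rewrite rpow_nonpos by lra. ring.
  - apply is_derive_ext with (fun y => y * rpow y (a - 1)).
    { intros y. symmetry. apply rpow_pred. }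
    eapply is_derive_eq.
    + apply (derive_id_mult_0 (fun y => rpow y (a - 1))). apply continuous_rpow; lra.
    + cbv beta. rewrite rpow_nonpos by lra. ring.
  - now apply derive_rpow_pos.
Qed.

Lemma rpow_neg_lim (a : R) :
  a < 0 -> filterlim (fun x => rpow x a) (Rbar_locally p_infty) (locally 0).
Proof.
  intros Ha. apply filterlim_locally. intros eps.
  assert (He := Rinv_0_lt_compat _ (cond_pos eps)).
  exists (rpow (/ eps) (/ - a)). intros x Hx.
  assert (Hx0 : 0 < x) by (apply Rlt_trans with (2 := Hx), rpow_gt0, He).
  change (Rabs (rpow x a - 0) < eps).
  rewrite Rminus_0_r, Rabs_right by apply Rle_ge, rpow_ge0.
  replace a with (- - a) by ring.
  rewrite (rpow_pos x), Rpower_Ropp, <- rpow_pos by assumption.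
  rewrite <- (Rinv_inv eps). apply Rinv_lt_contravar.
  - apply Rmult_lt_0_compat; [exact He|now apply rpow_gt0].
  - rewrite <- (rpow_inv (/ eps) (/ - a) (- a)) by (try lra; field; lra).
    apply rpow_lt; [lra|]. split; [apply rpow_ge0|exact Hx].
Qed.

(** The odd extension of [u |-> u ^ a] to negative [u]. *)
Definition spow (u a : R) : R := rpow (Rabs u) (a - 1) * u.

(** The sum and the difference of the two one-sided powers make continuity and
    differentiability at [0] consequences of those of [rpow]. *)
Lemma spow_split (u a : R) : spow u a = rpow u a - rpow (- u) a.
Proof.
  unfold spow. rewrite (rpow_pred u a), (rpow_pred (- u) a).
  destruct (Rle_lt_dec 0 u) as [H|H].
  - rewrite Rabs_right, (rpow_nonpos (- u)) by lra. ring.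
  - rewrite Rabs_left, (rpow_nonpos u) by lra. ring.
Qed.

Lemma rpow_abs_split (u a : R) : rpow (Rabs u) a = rpow u a + rpow (- u) a.
Proof.
  destruct (Rle_lt_dec 0 u) as [H|H].
  - rewrite Rabs_right, (rpow_nonpos (- u)) by lra. ring.
  - rewrite Rabs_left, (rpow_nonpos u) by lra. ring.
Qed.

Lemma spow_nonneg (u a : R) : 0 <= u -> spow u a = rpow u a.
Proof. intros H. rewrite spow_split, (rpow_nonpos (- u)) by lra. ring. Qed.

Lemma spow_opp (u a : R) : spow (- u) a = - spow u a.
Proof. unfold spow. rewrite Rabs_Ropp. ring. Qed.

Lemma spow_mult (u v a : R) : spow (u * v) a = spow u a * spow v a.
Proof.
  unfold spow. rewrite Rabs_mult, rpow_mult_base by apply Rabs_pos. ring.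
Qed.

Lemma continuous_spow (u a : R) : 0 < a -> continuous (fun v => spow v a) u.
Proof.
  intros Ha. apply continuous_ext with (fun v => rpow v a - rpow (- v) a).
  { intros v. symmetry. apply spow_split. }
  apply (continuous_minus (fun v => rpow v a) (fun v => rpow (- v) a)).
  - now apply continuous_rpow.
  - apply (continuous_comp Ropp (fun v => rpow v a)).
    + apply (continuous_opp (fun v : R => v)), continuous_id.
    + now apply continuous_rpow.
Qed.

Lemma continuous_rpow_abs (u a : R) : 0 < a -> continuous (fun v => rpow (Rabs v) a) u.
Proof.
  intros Ha. apply (continuous_comp Rabs (fun v => rpow v a)).
  - apply continuous_Rabs.
  - now apply continuous_rpow.
Qed.

Lemma derive_rpow_abs (u a : R) :
  1 < a -> is_derive (fun v => rpow (Rabs v) a) u (a * spow u (a - 1)).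
Proof.
  intros Ha. apply is_derive_ext with (fun v => rpow v a + rpow (- v) a).
  { intros v. symmetry. apply rpow_abs_split. }
  eapply is_derive_eq.
  - apply derive_plus; [now apply derive_rpow|].
    apply (derive_reflect (fun v => rpow v a)). now apply derive_rpow.
  - rewrite spow_split. ring.
Qed.

(** * The integral F and its limit at 1 *)

Lemma at_left_le (b : R) : at_left b (fun x => x < b).
Proof. unfold at_left, within. now apply filter_forall. Qed.

Section Fpq_properties.

Variables p q : R.
Hypothesis p_gt0 : 0 < p.
Hypothesis q_gt0 : 0 < q.

Lemma F_integrand_continuous (t : R) : t < 1 -> continuous (F_integrand p q) t.
Proof.
  intros Ht. unfold F_integrand.
  apply (continuous_comp (fun t => 1 - rpow t q) (fun v => rpow v (- / p))).
  - apply (continuous_minus (fun _ => 1) (fun t => rpow t q)).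
    + apply continuous_const.
    + now apply continuous_rpow.
  - eapply is_derive_continuous, derive_rpow_pos.
    assert (H := rpow_lt1 t q q_gt0 Ht). lra.
Qed.

Lemma F_integrand_ge1 (t : R) : t < 1 -> 1 <= F_integrand p q t.
Proof.
  intros Ht. unfold F_integrand.
  assert (H := rpow_lt1 t q q_gt0 Ht). assert (H' := rpow_ge0 t q).
  rewrite rpow_pos, Rpower_Ropp by lra. rewrite <- Rinv_1 at 1.
  apply Rinv_le_contravar; [apply exp_pos|].
  rewrite <- rpow_pos by lra. apply rpow_le1; [now apply Rinv_0_lt_compat|lra].
Qed.

Lemma F_integrand_ex_RInt (x : R) : x < 1 -> ex_RInt (F_integrand p q) 0 x.
Proof.
  intros Hx. apply (ex_RInt_continuous (V := R_CompleteNormedModule)). intros z [_ Hz].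
  apply F_integrand_continuous. apply Rle_lt_trans with (1 := Hz).
  apply Rmax_lub_lt; lra.
Qed.

Lemma Fpq_lt1 (x : R) : x < 1 -> Fpq p q x = RInt (F_integrand p q) 0 x.
Proof. unfold Fpq. destruct (Rlt_dec x 1); [reflexivity|lra]. Qed.

Lemma derive_Fpq (x : R) : x < 1 -> is_derive (Fpq p q) x (F_integrand p q x).
Proof.
  intros Hx. apply is_derive_RInt with 0; [|now apply F_integrand_continuous].
  assert (Hx' : 0 < 1 - x) by lra.
  exists (mkposreal _ Hx'). intros y Hy. change (Rabs (y - x) < 1 - x) in Hy.
  apply Rabs_def2 in Hy. rewrite Fpq_lt1 by lra.
  apply (RInt_correct (V := R_CompleteNormedModule)), F_integrand_ex_RInt; lra.
Qed.

Lemma Fpq_0 : Fpq p q 0 = 0.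
Proof. rewrite Fpq_lt1 by lra. exact (RInt_point 0 _). Qed.

(** Below [0] the convention [rpow t q = 0] makes the integrand equal to [1]. *)
Lemma Fpq_neg (x : R) : x <= 0 -> Fpq p q x = x.
Proof.
  intros Hx. rewrite Fpq_lt1 by lra.
  rewrite (RInt_ext _ (fun _ => 1)).
  - rewrite RInt_const. change ((x - 0) * 1 = x). ring.
  - rewrite Rmin_right, Rmax_left by lra. intros t Ht. unfold F_integrand.
    rewrite (rpow_nonpos t), Rminus_0_r by lra. apply rpow_base1.
Qed.

Lemma Fpq_expanding (x y : R) : x <= y < 1 -> y - x <= Fpq p q y - Fpq p q x.
Proof.
  intros [Hxy Hy].
  destruct (MVT_gen (Fpq p q) x y (F_integrand p q)) as [c [Hc E]].
  - rewrite Rmin_left, Rmax_right by lra. intros t Ht. apply derive_Fpq; lra.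
  - rewrite Rmin_left, Rmax_right by lra. intros t Ht.
    apply continuity_pt_filterlim.
    eapply is_derive_continuous, derive_Fpq; lra.
  - rewrite Rmin_left, Rmax_right in Hc by lra.
    assert (H := F_integrand_ge1 c). rewrite E.
    rewrite <- (Rmult_1_l (y - x)) at 1. apply Rmult_le_compat_r; lra.
Qed.

(** [F] being increasing, its limit at [1] can be computed along any curve that
    tends to [1] from below. *)
Lemma F_limit_along {T : Type} (G : (T -> Prop) -> Prop) (s : T -> R) (l : R) :
  ProperFilter G -> G (fun t => s t < 1) -> filterlim s G (locally 1) ->
  filterlim (fun t => Fpq p q (s t)) G (locally l) ->
  filterlim (Fpq p q) (at_left 1) (locally l).
Proof.
  intros HG Hlt Hs HF.
  assert (Hle : forall u, u < 1 -> Fpq p q u <= l).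
  { intros u Hu. assert (Hu' : 0 < 1 - u) by lra.
    apply (filterlim_le (F := G) (fun _ => Fpq p q u) (fun t => Fpq p q (s t))
             (Finite (Fpq p q u)) (Finite l)).
    - generalize (filter_and _ _ Hlt (proj1 (filterlim_locally _ _) Hs (mkposreal _ Hu'))).
      apply filter_imp. intros t [H1 H2]. change (Rabs (s t - 1) < 1 - u) in H2.
      apply Rabs_def2 in H2. assert (H := Fpq_expanding u (s t)). lra.
    - apply filterlim_const.
    - exact HF. }
  apply filterlim_locally. intros eps.
  destruct (filter_ex _ (filter_and _ _ Hlt (proj1 (filterlim_locally _ _) HF eps)))
    as [t [H1 H2]].
  change (Rabs (Fpq p q (s t) - l) < eps) in H2. apply Rabs_def2 in H2.
  assert (Hd : 0 < 1 - s t) by lra.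
  exists (mkposreal _ Hd). intros u Hu Hu1. change (Rabs (u - 1) < 1 - s t) in Hu.
  change (Rabs (Fpq p q u - l) < eps). apply Rabs_def2 in Hu.
  assert (H := Fpq_expanding (s t) u). assert (H' := Hle u Hu1).
  apply Rabs_def1; lra.
Qed.

(** * The generalised sine as an inverse, and its symmetries *)

Section sin_pq_properties.

Variable l : R.
Hypothesis F_lim : filterlim (Fpq p q) (at_left 1) (locally l).

Lemma Fpq_1 : Fpq p q 1 = l.
Proof.
  unfold Fpq. destruct (Rlt_dec 1 1) as [H|_]; [lra|].
  apply is_RInt_gen_unique; try apply Proper_StrongProper; try typeclasses eauto.
  apply is_RInt_gen_of_lim.
  - typeclasses eauto.
  - generalize (at_left_le 1). apply filter_imp, F_integrand_ex_RInt.
  - eapply filterlim_ext_loc; [|exact F_lim].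
    generalize (at_left_le 1). apply filter_imp, Fpq_lt1.
Qed.

Lemma Fpq_lt_limit (u : R) : u < 1 -> Fpq p q u < l.
Proof.
  intros Hu. assert (H := Fpq_expanding u ((u + 1) / 2)).
  assert (H' : 0 < 1 - (u + 1) / 2) by lra.
  apply Rlt_le_trans with (Fpq p q ((u + 1) / 2)); [lra|].
  apply (filterlim_le (F := at_left 1) (fun _ => Fpq p q ((u + 1) / 2)) (Fpq p q)
           (Finite (Fpq p q ((u + 1) / 2))) (Finite l)).
  - exists (mkposreal _ H'). intros v Hv Hv1.
    change (Rabs (v - 1) < 1 - (u + 1) / 2) in Hv. apply Rabs_def2 in Hv.
    assert (H2 := Fpq_expanding ((u + 1) / 2) v). lra.
  - apply filterlim_const.
  - exact F_lim.
Qed.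

Lemma limit_gt0 : 0 < l.
Proof. rewrite <- Fpq_0. apply Fpq_lt_limit. lra. Qed.

Lemma Fpq_increasing (u v : R) : u < v <= 1 -> Fpq p q u < Fpq p q v.
Proof.
  intros [Huv [Hv| ->]].
  - assert (H := Fpq_expanding u v). lra.
  - rewrite Fpq_1. now apply Fpq_lt_limit.
Qed.

Lemma Fpq_surjective (y : R) : 0 <= y <= l -> exists u, 0 <= u <= 1 /\ Fpq p q u = y.
Proof.
  intros [Hy0 [Hy| ->]]; [|exists 1; split; [lra|apply Fpq_1]].
  destruct Hy0 as [Hy0|<-]; [|exists 0; split; [lra|apply Fpq_0]].
  assert (He : 0 < l - y) by lra.
  destruct (filter_ex (F := at_left 1) _
    (filter_and _ _ (at_left_le 1) (proj1 (filterlim_locally _ _) F_lim (mkposreal _ He))))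
    as [v [Hv1 Hv]].
  change (Rabs (Fpq p q v - l) < l - y) in Hv. apply Rabs_def2 in Hv.
  assert (Hv0 : 0 < v).
  { destruct (Rle_lt_dec v 0) as [H|H]; [|exact H]. rewrite Fpq_neg in Hv; lra. }
  destruct (Ranalysis5.IVT_interv (fun u => Fpq p q u - y) 0 v) as [u [Hu E]].
  - intros u Hu. apply continuity_pt_filterlim.
    apply (continuous_minus (Fpq p q) (fun _ => y)).
    + eapply is_derive_continuous, derive_Fpq; lra.
    + apply continuous_const.
  - exact Hv0.
  - rewrite Fpq_0. lra.
  - lra.
  - exists u. cbv beta in E. split; lra.
Qed.

Lemma pi_pq_limit : pi_pq p q = 2 * l.
Proof. unfold pi_pq. now rewrite Fpq_1. Qed.

Lemma sin_pq_base_Fpq (u : R) : 0 <= u <= 1 -> sin_pq_base p q (Fpq p q u) = u.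
Proof.
  intros Hu. unfold sin_pq_base. apply (iota_unique (V := R_CompleteNormedModule)); [|now split].
  intros v [Hv E].
  destruct (Rtotal_order u v) as [H|[H|H]]; [|now symmetry|].
  - assert (H' := Fpq_increasing u v). lra.
  - assert (H' := Fpq_increasing v u). lra.
Qed.

Lemma sin_pq_fundamental (y : R) :
  - (2 * l) <= y < 2 * l -> sin_pq p q y = sin_pq_period p q y.
Proof.
  intros Hy. assert (Hl := limit_gt0). unfold sin_pq. rewrite pi_pq_limit.
  rewrite <- (Int_part_spec _ 0).
  - f_equal. ring.
  - split.
    + apply Rmult_lt_reg_r with (2 * (2 * l)); [lra|].
      rewrite Rmult_minus_distr_r. unfold Rdiv.
      rewrite Rmult_assoc, Rinv_l by lra. lra.
    + apply Rmult_le_reg_r with (2 * (2 * l)); [lra|]. unfold Rdiv.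
      rewrite Rmult_assoc, Rinv_l by lra. lra.
Qed.

Lemma sin_pq_periodic (y : R) : sin_pq p q (y + 4 * l) = sin_pq p q y.
Proof.
  assert (Hl := limit_gt0). unfold sin_pq. rewrite pi_pq_limit.
  assert (E : (y + 4 * l + 2 * l) / (2 * (2 * l)) = (y + 2 * l) / (2 * (2 * l)) + 1)
    by (field; lra).
  rewrite E, <- (Int_part_spec _ (Int_part ((y + 2 * l) / (2 * (2 * l))) + 1)).
  - rewrite plus_IZR. f_equal. ring.
  - rewrite plus_IZR.
    assert (H := base_Int_part ((y + 2 * l) / (2 * (2 * l)))). lra.
Qed.

Lemma sin_pq_first_quarter (y : R) : 0 <= y <= l -> sin_pq p q y = sin_pq_base p q y.
Proof.
  intros Hy. assert (Hl := limit_gt0). rewrite sin_pq_fundamental by lra.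
  unfold sin_pq_period, sin_pq_half. rewrite pi_pq_limit.
  destruct (Rle_dec 0 y); [|lra].
  destruct (Rle_dec y (2 * l / 2)); [reflexivity|lra].
Qed.

Lemma sin_pq_Fpq (u : R) : 0 <= u <= 1 -> sin_pq p q (Fpq p q u) = u.
Proof.
  intros Hu. rewrite sin_pq_first_quarter; [now apply sin_pq_base_Fpq|].
  split.
  - destruct (proj1 Hu) as [H|<-].
    + rewrite <- Fpq_0. apply Rlt_le, Fpq_increasing. lra.
    + rewrite Fpq_0. lra.
  - destruct (proj2 Hu) as [H| ->].
    + now apply Rlt_le, Fpq_lt_limit.
    + rewrite Fpq_1. lra.
Qed.

Lemma sin_pq_0 : sin_pq p q 0 = 0.
Proof. rewrite <- Fpq_0 at 1. apply sin_pq_Fpq. lra. Qed.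

Lemma sin_pq_half_reflect (y : R) :
  sin_pq_half p q (2 * l - y) = sin_pq_half p q y.
Proof.
  unfold sin_pq_half. rewrite pi_pq_limit.
  destruct (Rle_dec (2 * l - y) (2 * l / 2)), (Rle_dec y (2 * l / 2));
    try lra; f_equal; lra.
Qed.

Lemma sin_pq_half_0 : sin_pq_half p q 0 = 0.
Proof.
  assert (Hl := limit_gt0). transitivity (sin_pq p q 0); [|exact sin_pq_0].
  rewrite sin_pq_fundamental by lra. unfold sin_pq_period.
  destruct (Rle_dec 0 0); [reflexivity|lra].
Qed.

(** A half period exchanges the two halves of the fundamental interval
    [[- 2 l, 2 l)], and [sin_pq_half] is symmetric about [l]. *)
Lemma sin_pq_antiperiodic (y : R) : sin_pq p q (y + 2 * l) = - sin_pq p q y.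
Proof.
  assert (Hl := limit_gt0).
  assert (Hneg : forall z, - (2 * l) <= z < 0 -> sin_pq p q (z + 2 * l) = - sin_pq p q z).
  { intros z Hz. rewrite !sin_pq_fundamental by lra. unfold sin_pq_period.
    destruct (Rle_dec 0 (z + 2 * l)); [|lra]. destruct (Rle_dec 0 z); [lra|].
    rewrite Ropp_involutive, <- sin_pq_half_reflect. f_equal. ring. }
  revert y. apply (periodic_ind _ (- (2 * l)) (4 * l)); [lra| |].
  - intros y. replace (y + 4 * l + 2 * l) with (y + 2 * l + 4 * l) by ring.
    now rewrite !sin_pq_periodic.
  - intros y Hy. destruct (Rlt_le_dec y 0) as [H|H]; [apply Hneg; lra|].
    assert (E := Hneg (y - 2 * l)).
    replace (y - 2 * l + 2 * l) with y in E by ring.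
    rewrite <- (sin_pq_periodic (y - 2 * l)) in E.
    replace (y - 2 * l + 4 * l) with (y + 2 * l) in E by ring.
    rewrite E by lra. ring.
Qed.

Lemma sin_pq_odd (y : R) : sin_pq p q (- y) = - sin_pq p q y.
Proof.
  assert (Hl := limit_gt0).
  revert y. apply (periodic_ind _ (- (2 * l)) (4 * l)); [lra| |].
  - intros y. rewrite sin_pq_periodic.
    rewrite <- (sin_pq_periodic (- (y + 4 * l))).
    now replace (- (y + 4 * l) + 4 * l) with (- y) by ring.
  - intros y [[Hy1|<-] Hy2].
    + rewrite !sin_pq_fundamental by lra. unfold sin_pq_period.
      destruct (Rle_dec 0 (- y)), (Rle_dec 0 y); try lra.
      * replace y with 0 by lra. rewrite Ropp_0, sin_pq_half_0. ring.
      * now rewrite Ropp_involutive.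
    + assert (E1 := sin_pq_antiperiodic 0). assert (E2 := sin_pq_antiperiodic (- (2 * l))).
      rewrite Rplus_0_l, sin_pq_0 in E1. rewrite Rplus_opp_l, sin_pq_0 in E2.
      rewrite Ropp_involutive. lra.
Qed.

Lemma sin_pq_reflect (y : R) : sin_pq p q (2 * l - y) = sin_pq p q y.
Proof.
  replace (2 * l - y) with (- y + 2 * l) by ring.
  rewrite sin_pq_antiperiodic, sin_pq_odd. ring.
Qed.

Lemma sin_pq_inverse (y : R) :
  0 <= y <= l -> 0 <= sin_pq p q y <= 1 /\ Fpq p q (sin_pq p q y) = y.
Proof.
  intros Hy. destruct (Fpq_surjective y Hy) as [u [Hu <-]].
  now rewrite sin_pq_Fpq.
Qed.

Lemma sin_pq_1 : sin_pq p q l = 1.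
Proof. rewrite <- Fpq_1. apply sin_pq_Fpq. lra. Qed.

End sin_pq_properties.

End Fpq_properties.

(** * Duality for conjugate exponents *)

Lemma conj_exp_gt0 (q : R) : 1 < q -> 0 < conj_exp q.
Proof. intros Hq. unfold conj_exp. apply Rdiv_lt_0_compat; lra. Qed.

Lemma F_integrand_conj (q t : R) :
  1 < q -> F_integrand (conj_exp q) q t = rpow (1 - rpow t q) (/ q - 1).
Proof. intros Hq. unfold F_integrand, conj_exp. f_equal. field. lra. Qed.

(** The involution [u |-> v] of [[0, 1]] with [u ^ q + v ^ q = 1]. *)
Definition fermat_dual (q u : R) : R := rpow (1 - rpow u q) (/ q).

Definition fermat_mid (q : R) : R := rpow (/ 2) (/ q).

Section conjugate.

Variable q : R.
Hypothesis q_gt1 : 1 < q.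

Notation F := (Fpq (conj_exp q) q).

Lemma q_gt0 : 0 < q. Proof. lra. Qed.

Lemma inv_q_gt0 : 0 < / q. Proof. apply Rinv_0_lt_compat. lra. Qed.

Lemma conj_gt0 : 0 < conj_exp q. Proof. now apply conj_exp_gt0. Qed.

Lemma fermat_dual_pow (u : R) : u <= 1 -> rpow (fermat_dual q u) q = 1 - rpow u q.
Proof.
  intros Hu. unfold fermat_dual. apply rpow_inv.
  - assert (H := rpow_le1 u q q_gt0 Hu). lra.
  - field. lra.
Qed.

Lemma fermat_dual_bounds (u : R) : u <= 1 -> 0 <= fermat_dual q u <= 1.
Proof.
  intros Hu. split; [apply rpow_ge0|].
  apply rpow_le1; [exact inv_q_gt0|]. assert (H := rpow_ge0 u q). lra.
Qed.

Lemma fermat_dual_lt1 (u : R) : 0 < u -> fermat_dual q u < 1.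
Proof.
  intros Hu. apply rpow_lt1; [exact inv_q_gt0|].
  assert (H := rpow_gt0 u q Hu). lra.
Qed.

Lemma fermat_dual_0 : fermat_dual q 0 = 1.
Proof.
  unfold fermat_dual. rewrite (rpow_nonpos 0), Rminus_0_r by lra. apply rpow_base1.
Qed.

Lemma fermat_dual_1 : fermat_dual q 1 = 0.
Proof. unfold fermat_dual. rewrite rpow_base1. apply rpow_nonpos. lra. Qed.

Lemma fermat_mid_pow : rpow (fermat_mid q) q = / 2.
Proof. apply rpow_inv; [lra|field; lra]. Qed.

Lemma fermat_mid_bounds : 0 < fermat_mid q < 1.
Proof.
  split.
  - apply rpow_gt0. lra.
  - apply rpow_lt1; [exact inv_q_gt0|lra].
Qed.

Lemma fermat_dual_mid : fermat_dual q (fermat_mid q) = fermat_mid q.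
Proof. unfold fermat_dual. rewrite fermat_mid_pow. unfold fermat_mid. f_equal. lra. Qed.

Lemma derive_fermat_dual (u : R) :
  u < 1 ->
  is_derive (fermat_dual q) u (- (rpow (1 - rpow u q) (/ q - 1) * rpow u (q - 1))).
Proof.
  intros Hu. assert (H := rpow_lt1 u q q_gt0 Hu). eapply is_derive_eq.
  - apply (derive_comp (fun v => rpow v (/ q)) (fun u => 1 - rpow u q)).
    + apply derive_rpow_pos. lra.
    + apply (derive_minus (fun _ => 1)).
      * apply (is_derive_const (K := R_AbsRing) (V := R_NormedModule)).
      * now apply derive_rpow.
  - change (@zero R_NormedModule) with 0. field. lra.
Qed.

(** The curve [u ^ q + v ^ q = 1] is traced with [F' (u) du = - F' (v) dv], so [F u + F v]
    is constant on it; the value is read at [u = v]. *)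
Lemma F_duality (u : R) :
  0 < u < 1 -> F u + F (fermat_dual q u) = 2 * F (fermat_mid q).
Proof.
  assert (Hd : forall t, 0 < t < 1 -> is_derive (fun u => F u + F (fermat_dual q u)) t 0).
  { intros t Ht. assert (H := fermat_dual_lt1 t). eapply is_derive_eq.
    - apply derive_plus.
      + apply derive_Fpq; [exact q_gt0|lra].
      + apply (derive_comp F (fermat_dual q)).
        * apply derive_Fpq; [exact q_gt0|lra].
        * apply derive_fermat_dual. lra.
    - rewrite !F_integrand_conj by assumption. rewrite fermat_dual_pow by lra.
      replace (1 - (1 - rpow t q)) with (rpow t q) by ring. rewrite rpow_rpow.
      assert (E : rpow t (q * (/ q - 1)) * rpow t (q - 1) = 1).
      { rewrite <- rpow_plus. replace (q * (/ q - 1) + (q - 1)) with 0 by (field; lra).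
        rewrite rpow_pos by lra. apply Rpower_O. lra. }
      transitivity (rpow (1 - rpow t q) (/ q - 1)
        * (1 - rpow t (q * (/ q - 1)) * rpow t (q - 1))); [ring|].
      rewrite E. ring. }
  assert (Hm := fermat_mid_bounds). intros Hu.
  transitivity (F (fermat_mid q) + F (fermat_dual q (fermat_mid q)));
    [|rewrite fermat_dual_mid; ring].
  destruct (Rtotal_order u (fermat_mid q)) as [H|[->|H]].
  - apply (eq_is_derive (fun u => F u + F (fermat_dual q u))); [|exact H].
    intros t Ht. apply Hd. lra.
  - reflexivity.
  - symmetry. apply (eq_is_derive (fun u => F u + F (fermat_dual q u))); [|exact H].
    intros t Ht. apply Hd. lra.
Qed.

(** Along [v = fermat_dual q u] with [u] tending to [0], duality turns the singular
    end of [F] into its regular one: the improper integral converges. *)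
Lemma F_limit_conj : filterlim F (at_left 1) (locally (2 * F (fermat_mid q))).
Proof.
  apply (F_limit_along _ _ conj_gt0 q_gt0 (at_right 0) (fermat_dual q)).
  - apply at_right_proper_filter.
  - exists (mkposreal 1 Rlt_0_1). intros t _ Ht. now apply fermat_dual_lt1.
  - apply (filterlim_filter_le_1 (F := locally 0)); [apply filter_le_within|].
    rewrite <- fermat_dual_0. eapply is_derive_continuous, derive_fermat_dual. lra.
  - apply filterlim_ext_loc with (fun t => 2 * F (fermat_mid q) - F t).
    + exists (mkposreal 1 Rlt_0_1). intros t Ht Ht0. change (Rabs (t - 0) < 1) in Ht.
      apply Rabs_def2 in Ht. rewrite <- (F_duality t) by lra. ring.
    + apply (filterlim_filter_le_1 (F := locally 0)); [apply filter_le_within|].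
      assert (H : continuous (fun t => 2 * F (fermat_mid q) - F t) 0).
      { apply (continuous_minus (fun _ => 2 * F (fermat_mid q)) F).
        - apply continuous_const.
        - eapply is_derive_continuous, derive_Fpq; [exact q_gt0|lra]. }
      unfold continuous in H. rewrite Fpq_0, Rminus_0_r in H. exact H.
Qed.

(** * Derivative of the sine for conjugate exponents *)

(** A quarter of a period, [pi_pq (conj_exp q) q / 2]. *)
Definition quarter : R := 2 * F (fermat_mid q).

Notation S := (sin_pq (conj_exp q) q).

(** The derivative of [S] is the signed power of exponent [q - 1] of this function; the two
    coincide only for [q = 2]. *)
Definition cosine (x : R) : R := S (x + quarter).

Lemma quarter_gt0 : 0 < quarter.
Proof. exact (limit_gt0 _ _ conj_gt0 q_gt0 _ F_limit_conj). Qed.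

Lemma sin_conj_odd (x : R) : S (- x) = - S x.
Proof. exact (sin_pq_odd _ _ conj_gt0 q_gt0 _ F_limit_conj x). Qed.

Lemma sin_conj_0 : S 0 = 0.
Proof. exact (sin_pq_0 _ _ conj_gt0 q_gt0 _ F_limit_conj). Qed.

Lemma sin_conj_antiperiodic (x : R) : S (x + 2 * quarter) = - S x.
Proof. exact (sin_pq_antiperiodic _ _ conj_gt0 q_gt0 _ F_limit_conj x). Qed.

Lemma sin_conj_reflect (x : R) : S (2 * quarter - x) = S x.
Proof. exact (sin_pq_reflect _ _ conj_gt0 q_gt0 _ F_limit_conj x). Qed.

Lemma sin_conj_F (u : R) : 0 <= u <= 1 -> S (F u) = u.
Proof. exact (sin_pq_Fpq _ _ conj_gt0 q_gt0 _ F_limit_conj u). Qed.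

Lemma sin_conj_inverse (x : R) : 0 <= x <= quarter -> 0 <= S x <= 1 /\ F (S x) = x.
Proof. exact (sin_pq_inverse _ _ conj_gt0 q_gt0 _ F_limit_conj x). Qed.

Lemma F_conj_1 : F 1 = quarter.
Proof. exact (Fpq_1 _ _ q_gt0 _ F_limit_conj). Qed.

Lemma F_conj_0 : F 0 = 0.
Proof. exact (Fpq_0 _ _). Qed.

Lemma derive_F_conj (u : R) : u < 1 -> is_derive F u (rpow (1 - rpow u q) (/ q - 1)).
Proof.
  intros Hu. rewrite <- F_integrand_conj by assumption.
  now apply derive_Fpq; [exact q_gt0|].
Qed.

Lemma cosine_even (x : R) : cosine (- x) = cosine x.
Proof.
  unfold cosine. rewrite <- (sin_conj_reflect (x + quarter)). f_equal. ring.
Qed.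

Lemma cosine_add_quarter (x : R) : cosine (x + quarter) = - S x.
Proof.
  unfold cosine. rewrite <- sin_conj_antiperiodic. f_equal. ring.
Qed.

(** By duality [F (fermat_dual q (S x)) = quarter - x], and [S] is symmetric about
    [quarter]. *)
Lemma cosine_first_quarter (x : R) : 0 <= x <= quarter -> cosine x = fermat_dual q (S x).
Proof.
  intros Hx. destruct (sin_conj_inverse x Hx) as [Hu E].
  assert (Hd := fermat_dual_bounds (S x) (proj2 Hu)).
  assert (E' : F (fermat_dual q (S x)) = quarter - x).
  { rewrite <- E at 2. destruct Hu as [[H0|H0] [H1|H1]].
    - unfold quarter. rewrite <- (F_duality (S x)) by lra. ring.
    - rewrite H1, fermat_dual_1, F_conj_0, F_conj_1. ring.
    - rewrite <- H0, fermat_dual_0, F_conj_0, F_conj_1. ring.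
    - lra. }
  unfold cosine. rewrite <- (sin_conj_F (fermat_dual q (S x)) Hd), E', <- sin_conj_reflect.
  f_equal. ring.
Qed.

Lemma sin_conj_abs_even (x : R) : Rabs (S (- x)) = Rabs (S x).
Proof. rewrite sin_conj_odd. apply Rabs_Ropp. Qed.

Lemma cosine_dual (x : R) : Rabs x <= quarter -> cosine x = fermat_dual q (Rabs (S x)).
Proof.
  intros Hx. destruct (Rle_lt_dec 0 x) as [H|H].
  - rewrite Rabs_right in Hx by lra. rewrite cosine_first_quarter by lra.
    destruct (sin_conj_inverse x) as [Hu _]; [lra|]. now rewrite (Rabs_right (S x)) by lra.
  - rewrite Rabs_left in Hx by lra.
    rewrite <- cosine_even, <- sin_conj_abs_even, cosine_first_quarter by lra.
    destruct (sin_conj_inverse (- x)) as [Hu _]; [lra|]. now rewrite (Rabs_right (S (- x))) by lra.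
Qed.

(** The odd extension of [F] from [[0, 1)] to [(-1, 1)], written without case
    distinction: the integrand is [1] on the negative side, so [F (- |u|) = - |u|]. *)
Definition F_odd (u : R) : R := F u - F (- u) - u.

Lemma F_odd_nonneg (u : R) : 0 <= u -> F_odd u = F u.
Proof. intros Hu. unfold F_odd. rewrite (Fpq_neg _ _ (- u)) by lra. ring. Qed.

Lemma F_odd_opp (u : R) : F_odd (- u) = - F_odd u.
Proof. unfold F_odd. rewrite Ropp_involutive. ring. Qed.

Lemma derive_F_odd (u : R) :
  Rabs u < 1 -> is_derive F_odd u (rpow (1 - rpow (Rabs u) q) (/ q - 1)).
Proof.
  intros Hu. apply Rabs_def2 in Hu. eapply is_derive_eq.
  - apply (derive_minus (fun u => F u - F (- u)) (fun u => u)).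
    + apply derive_minus; [apply derive_F_conj; lra|].
      apply (derive_reflect F). apply derive_F_conj. lra.
    + apply (is_derive_id (K := R_AbsRing)).
  - change (@one R_AbsRing) with 1. destruct (Rle_lt_dec 0 u) as [H|H].
    + rewrite Rabs_right, (rpow_nonpos (- u)), Rminus_0_r, rpow_base1 by lra. ring.
    + rewrite Rabs_left, (rpow_nonpos u), Rminus_0_r, rpow_base1 by lra. ring.
Qed.

Lemma F_odd_sin_conj (x : R) : Rabs x <= quarter -> F_odd (S x) = x.
Proof.
  intros Hx. destruct (Rle_lt_dec 0 x) as [H|H].
  - rewrite Rabs_right in Hx by lra. destruct (sin_conj_inverse x) as [Hu E]; [lra|].
    now rewrite F_odd_nonneg.
  - rewrite Rabs_left in Hx by lra. destruct (sin_conj_inverse (- x)) as [Hu E]; [lra|].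
    rewrite <- (Ropp_involutive x) at 1. rewrite sin_conj_odd, F_odd_opp, F_odd_nonneg by lra. lra.
Qed.

Lemma sin_conj_abs_lt1 (x : R) : Rabs x < quarter -> Rabs (S x) < 1.
Proof.
  assert (Hpos : forall y, 0 <= y < quarter -> Rabs (S y) < 1).
  { intros y Hy. destruct (sin_conj_inverse y) as [Hu E]; [lra|].
    rewrite Rabs_right by lra. destruct Hu as [_ [H|H]]; [exact H|].
    rewrite H, F_conj_1 in E. lra. }
  intros Hx. destruct (Rle_lt_dec 0 x) as [H|H].
  - rewrite Rabs_right in Hx by lra. apply Hpos. lra.
  - rewrite Rabs_left in Hx by lra. rewrite <- sin_conj_abs_even. apply Hpos. lra.
Qed.

Lemma rpow_slope_ge1 (v : R) : 0 < v <= 1 -> 1 <= rpow v (/ q - 1).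
Proof.
  intros Hv. assert (H : 0 < 1 - / q).
  { rewrite <- Rinv_1 at 1. assert (H := Rinv_1_lt_contravar 1 q). lra. }
  replace (/ q - 1) with (- (1 - / q)) by ring.
  rewrite rpow_pos, Rpower_Ropp, <- rpow_pos by lra.
  rewrite <- Rinv_1 at 1. apply Rinv_le_contravar; [now apply rpow_gt0|].
  apply rpow_le1; lra.
Qed.

(** [S] inverts [F_odd], whose derivative is at least [1]. *)
Lemma sin_conj_lipschitz (x y : R) :
  Rabs x < quarter -> Rabs y < quarter -> Rabs (S y - S x) <= Rabs (y - x).
Proof.
  intros Hx Hy.
  assert (Hx1 := sin_conj_abs_lt1 x Hx). assert (Hy1 := sin_conj_abs_lt1 y Hy).
  apply Rabs_def2 in Hx1. apply Rabs_def2 in Hy1.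
  assert (Hb : forall t, Rmin (S x) (S y) <= t <= Rmax (S x) (S y) -> Rabs t < 1).
  { intros t Ht. apply Rabs_def1.
    - apply Rle_lt_trans with (1 := proj2 Ht). apply Rmax_lub_lt; lra.
    - apply Rlt_le_trans with (2 := proj1 Ht). apply Rmin_glb_lt; lra. }
  destruct (MVT_gen F_odd (S x) (S y) (fun u => rpow (1 - rpow (Rabs u) q) (/ q - 1)))
    as [c [Hc E]].
  - intros t Ht. apply derive_F_odd, Hb. lra.
  - intros t Ht. apply continuity_pt_filterlim.
    eapply is_derive_continuous, derive_F_odd, Hb, Ht.
  - rewrite !F_odd_sin_conj in E by lra. rewrite E, Rabs_mult.
    rewrite <- (Rmult_1_l (Rabs (S y - S x))) at 1.
    apply Rmult_le_compat_r; [apply Rabs_pos|].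
    assert (H := rpow_lt1 (Rabs c) q q_gt0 (Hb c Hc)).
    assert (H' := rpow_ge0 (Rabs c) q).
    apply Rle_trans with (2 := Rle_abs _). apply rpow_slope_ge1. lra.
Qed.

Lemma near_within (x : R) : Rabs x < quarter -> locally x (fun y => Rabs y < quarter).
Proof.
  intros Hx. assert (H : 0 < quarter - Rabs x) by lra.
  exists (mkposreal _ H). intros y Hy. change (Rabs (y - x) < quarter - Rabs x) in Hy.
  assert (H' := Rabs_triang_inv y x). lra.
Qed.

Lemma sin_conj_continuous_near (x : R) : Rabs x < quarter -> continuous S x.
Proof.
  intros Hx. apply filterlim_locally. intros eps.
  generalize (filter_and _ _ (near_within x Hx) (locally_ball x eps)).
  apply filter_imp. intros y [Hy Hxy].
  change (Rabs (S y - S x) < eps). apply Rle_lt_trans with (2 := Hxy).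
  now apply sin_conj_lipschitz.
Qed.

Lemma derive_sin_conj_near (x : R) : Rabs x < quarter -> is_derive S x (spow (cosine x) (q - 1)).
Proof.
  intros Hx. assert (H := rpow_lt1 _ q q_gt0 (sin_conj_abs_lt1 x Hx)).
  eapply is_derive_eq.
  - apply (derive_inverse F_odd S).
    + generalize (near_within x Hx). apply filter_imp. intros y Hy. apply F_odd_sin_conj. lra.
    + now apply sin_conj_continuous_near.
    + now apply derive_F_odd, sin_conj_abs_lt1.
    + apply Rgt_not_eq, rpow_gt0. lra.
  - rewrite cosine_dual by lra. rewrite spow_nonneg by apply rpow_ge0.
    unfold fermat_dual. rewrite rpow_rpow, !(rpow_pos (1 - _)) by lra.
    rewrite <- Rpower_Ropp. f_equal. field. lra.
Qed.

(** The derivative of [|u| ^ q] at [u = S 0 = 0] vanishes since [q > 1]. *)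
Lemma derive_cosine_0 : is_derive cosine 0 0.
Proof.
  assert (H0 : Rabs 0 < quarter) by (rewrite Rabs_R0; apply quarter_gt0).
  apply is_derive_ext_loc with (fun x => rpow (1 - rpow (Rabs (S x)) q) (/ q)).
  - generalize (near_within 0 H0). apply filter_imp. intros x Hx.
    rewrite cosine_dual by lra. reflexivity.
  - eapply is_derive_eq.
    + apply (derive_comp (fun v => rpow v (/ q)) (fun x => 1 - rpow (Rabs (S x)) q)).
      * apply derive_rpow_pos. assert (H := rpow_lt1 _ q q_gt0 (sin_conj_abs_lt1 0 H0)). lra.
      * apply (derive_minus (fun _ => 1)).
        -- apply (is_derive_const (K := R_AbsRing) (V := R_NormedModule)).
        -- apply (derive_comp (fun v => rpow (Rabs v) q) S).
           ++ now apply derive_rpow_abs.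
           ++ now apply derive_sin_conj_near.
    + change (@zero R_NormedModule) with 0. rewrite sin_conj_0. unfold spow at 1. ring.
Qed.

(** The inverse function theorem gives this on the open quarter-periods around [0].
    At the trough [- quarter], where [F] has a vertical tangent, [S] is minus a translate
    of [cosine]; antiperiodicity does the rest. *)
Lemma derive_sin_conj (x : R) : is_derive S x (spow (cosine x) (q - 1)).
Proof.
  assert (Hl := quarter_gt0).
  assert (Hc : forall x, cosine (x + 2 * quarter) = - cosine x).
  { intros x'. unfold cosine. rewrite <- sin_conj_antiperiodic. f_equal. ring. }
  assert (Hback : forall z, - S (z + - (2 * quarter)) = S z).
  { intros z. rewrite <- sin_conj_antiperiodic. f_equal. ring. }
  revert x. apply (periodic_ind _ (- quarter) (2 * quarter)); [lra| |].
  - intros x. rewrite Hc, spow_opp. split; intros H.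
    + apply is_derive_ext with (fun z => - S (z + - (2 * quarter))).
      { exact Hback. }
      apply (derive_opp (fun z => S (z + - (2 * quarter)))), derive_shift.
      now replace (x + 2 * quarter + - (2 * quarter)) with x by ring.
    + rewrite <- (Ropp_involutive (spow _ _)).
      apply is_derive_ext with (fun z => - S (z + 2 * quarter)).
      { intros z. rewrite sin_conj_antiperiodic. apply Ropp_involutive. }
      now apply (derive_opp (fun z => S (z + 2 * quarter))), derive_shift.
  - intros x [[Hx|Hx] Hx2].
    + apply derive_sin_conj_near. apply Rabs_def1; lra.
    + rewrite <- Hx. eapply is_derive_eq.
      * apply is_derive_ext with (fun z => - cosine (z + quarter)).
        { intros z. rewrite cosine_add_quarter. apply Ropp_involutive. }
        apply (derive_opp (fun z => cosine (z + quarter))), derive_shift.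
        rewrite Rplus_opp_l. exact derive_cosine_0.
      * unfold cosine. rewrite Rplus_opp_l, sin_conj_0. unfold spow. ring.
Qed.

Lemma sin_conj_continuous (x : R) : continuous S x.
Proof. eapply is_derive_continuous, derive_sin_conj. Qed.

Lemma cosine_continuous (x : R) : continuous cosine x.
Proof. eapply is_derive_continuous. unfold cosine. apply derive_shift, derive_sin_conj. Qed.

Lemma cosine_0 : cosine 0 = 1.
Proof.
  rewrite cosine_first_quarter, sin_conj_0; [apply fermat_dual_0|].
  assert (H := quarter_gt0). lra.
Qed.

Lemma sin_conj_abs_le1 (x : R) : Rabs (S x) <= 1.
Proof.
  assert (Hl := quarter_gt0).
  revert x. apply (periodic_ind _ (- quarter) (2 * quarter)); [lra| |].
  - intros x. rewrite sin_conj_antiperiodic, Rabs_Ropp. reflexivity.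
  - intros x [[Hx|<-] Hx2].
    + apply Rlt_le, sin_conj_abs_lt1, Rabs_def1; lra.
    + rewrite sin_conj_abs_even. destruct (sin_conj_inverse quarter) as [H _]; [lra|].
      rewrite Rabs_right; lra.
Qed.

(** * The double-angle formula *)

Definition double_factor : R := Rpower 2 (2 / q).

Notation k := double_factor.
Notation F2 := (Fpq 2 q).
Notation s := (sin_pq 2 q).

(** The double-angle formula at [x = F u]: there [S x = u] and
    [cosine x = fermat_dual q u]. *)
Definition double_sin (u : R) : R := k * (u * fermat_dual q u).

Lemma double_factor_gt0 : 0 < k.
Proof. apply exp_pos. Qed.

Lemma double_factor_pow : rpow k q = 4.
Proof.
  rewrite rpow_pos by apply double_factor_gt0. unfold double_factor.
  rewrite Rpower_mult. replace (2 / q * q) with (INR 2) by (simpl; field; lra).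
  rewrite Rpower_pow by lra. ring.
Qed.

Lemma double_sin_ge0 (u : R) : 0 <= u <= 1 -> 0 <= double_sin u.
Proof.
  intros Hu. assert (H := fermat_dual_bounds u (proj2 Hu)).
  assert (H' := double_factor_gt0). unfold double_sin.
  apply Rmult_le_pos; [lra|]. apply Rmult_le_pos; lra.
Qed.

(** With [a = u ^ q] this is [1 - 4 a (1 - a) = (1 - 2 a) ^ 2]; the factor [4 = k ^ q] dictates
    the value of [k]. *)
Lemma double_sin_pow (u : R) :
  0 <= u <= 1 ->
  1 - rpow (double_sin u) q = (1 - 2 * rpow u q) * (1 - 2 * rpow u q).
Proof.
  intros Hu. assert (H := fermat_dual_bounds u (proj2 Hu)).
  assert (H' := double_factor_gt0). unfold double_sin.
  rewrite !rpow_mult_base, double_factor_pow, fermat_dual_pow; try lra.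
  apply Rmult_le_pos; lra.
Qed.

Lemma below_mid_pow (u : R) : 0 <= u < fermat_mid q -> rpow u q < / 2.
Proof.
  intros Hu. rewrite <- fermat_mid_pow. apply rpow_lt; [exact q_gt0|exact Hu].
Qed.

Lemma double_sin_lt1 (u : R) : 0 <= u < fermat_mid q -> double_sin u < 1.
Proof.
  intros Hu. assert (Hm := fermat_mid_bounds). assert (H := below_mid_pow u Hu).
  assert (E := double_sin_pow u). destruct (Rlt_le_dec (double_sin u) 1) as [H1|H1]; [exact H1|].
  assert (H2 := rpow_le 1 (double_sin u) q q_gt0). rewrite rpow_base1 in H2.
  assert (H3 : 0 < (1 - 2 * rpow u q) * (1 - 2 * rpow u q)) by (apply Rmult_lt_0_compat; lra).
  lra.
Qed.

Lemma double_sin_mid : double_sin (fermat_mid q) = 1.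
Proof.
  assert (Hm := fermat_mid_bounds).
  rewrite <- (rpow_inv (double_sin (fermat_mid q)) q (/ q)).
  - assert (E := double_sin_pow (fermat_mid q)). rewrite fermat_mid_pow in E.
    replace (rpow (double_sin (fermat_mid q)) q) with 1 by lra. apply rpow_base1.
  - apply double_sin_ge0. lra.
  - field. lra.
Qed.

Lemma derive_double_sin (u : R) :
  u < 1 ->
  is_derive double_sin u (k * (rpow (1 - rpow u q) (/ q - 1) * (1 - 2 * rpow u q))).
Proof.
  intros Hu. eapply is_derive_eq.
  - apply (is_derive_scal (fun u => u * fermat_dual q u)).
    apply (derive_mult (fun u => u)).
    + apply (is_derive_id (K := R_AbsRing)).
    + now apply derive_fermat_dual.
  - change (@one R_AbsRing) with 1. unfold fermat_dual.
    rewrite (rpow_pred (1 - rpow u q) (/ q)).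
    assert (E := rpow_pred u q).
    replace (u * - (rpow (1 - rpow u q) (/ q - 1) * rpow u (q - 1)))
      with (- (rpow (1 - rpow u q) (/ q - 1) * (u * rpow u (q - 1)))) by ring.
    rewrite <- E. ring.
Qed.

(** The two sides vanish at [0] and have the same derivative, because
    [(1 - double_sin u ^ q) ^ (- 1 / 2)] cancels the factor [1 - 2 u ^ q] in the derivative of
    [double_sin]. *)
Lemma F2_double_sin_below (u : R) :
  0 <= u < fermat_mid q -> F2 (double_sin u) = k * F u.
Proof.
  assert (Hm := fermat_mid_bounds).
  assert (Hd : forall t, 0 <= t < fermat_mid q ->
    is_derive (fun u => F2 (double_sin u) - k * F u) t 0).
  { intros t Ht. assert (H := below_mid_pow t Ht). eapply is_derive_eq.
    - apply derive_minus.
      + apply (derive_comp F2 double_sin).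
        * apply derive_Fpq; [exact q_gt0|now apply double_sin_lt1].
        * apply derive_double_sin. lra.
      + apply is_derive_scal, derive_F_conj. lra.
    - unfold F_integrand. rewrite double_sin_pow by lra.
      rewrite rpow_mult_base, <- rpow_plus by lra.
      replace (- / 2 + - / 2) with (- (1)) by field.
      rewrite (rpow_pos (1 - 2 * _)), Rpower_Ropp, Rpower_1 by lra. field. lra. }
  assert (E0 : F2 (double_sin 0) - k * F 0 = 0).
  { unfold double_sin. rewrite Rmult_0_l, Rmult_0_r, !Fpq_0. ring. }
  intros [[Hu|<-] Hu1]; [|lra].
  apply Rminus_diag_uniq. rewrite <- E0. symmetry.
  apply (eq_is_derive (fun u => F2 (double_sin u) - k * F u)); [|exact Hu].
  intros t Ht. apply Hd. lra.
Qed.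

(** [double_sin] reaches [1] already at [fermat_mid q < 1], where [F] is regular. *)
Lemma F2_limit : filterlim F2 (at_left 1) (locally (k * F (fermat_mid q))).
Proof.
  assert (Hm := fermat_mid_bounds).
  assert (Hnear : at_left (fermat_mid q) (fun t => 0 <= t < fermat_mid q)).
  { exists (mkposreal _ (proj1 Hm)). intros t Ht Ht1.
    change (Rabs (t - fermat_mid q) < fermat_mid q) in Ht. apply Rabs_def2 in Ht. lra. }
  apply (F_limit_along 2 q Rlt_0_2 q_gt0 (at_left (fermat_mid q)) double_sin).
  - apply at_left_proper_filter.
  - generalize Hnear. apply filter_imp, double_sin_lt1.
  - apply (filterlim_filter_le_1 (F := locally (fermat_mid q))); [apply filter_le_within|].
    rewrite <- double_sin_mid. eapply is_derive_continuous, derive_double_sin. lra.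
  - apply filterlim_ext_loc with (fun u => k * F u).
    + generalize Hnear. apply filter_imp. intros t Ht. symmetry. now apply F2_double_sin_below.
    + apply (filterlim_filter_le_1 (F := locally (fermat_mid q))); [apply filter_le_within|].
      change (continuous (fun u => k * F u) (fermat_mid q)).
      eapply is_derive_continuous, is_derive_scal, derive_F_conj. lra.
Qed.

Lemma F2_double_sin (u : R) : 0 <= u <= fermat_mid q -> F2 (double_sin u) = k * F u.
Proof.
  intros [Hu0 [Hu| ->]].
  - apply F2_double_sin_below. lra.
  - rewrite double_sin_mid. exact (Fpq_1 2 q q_gt0 _ F2_limit).
Qed.

Lemma sin_2q_double_quarter (x : R) :
  0 <= x <= F (fermat_mid q) -> s (k * x) = k * (S x * cosine x).
Proof.
  assert (Hm := fermat_mid_bounds). assert (Hl := quarter_gt0). unfold quarter in Hl.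
  intros Hx. rewrite cosine_first_quarter by (unfold quarter; lra).
  destruct (sin_conj_inverse x) as [Hu E]; [unfold quarter; lra|].
  assert (Hu' : S x <= fermat_mid q).
  { destruct (Rle_lt_dec (S x) (fermat_mid q)) as [H|H]; [exact H|].
    assert (H' := Fpq_increasing _ _ conj_gt0 q_gt0 _ F_limit_conj (fermat_mid q) (S x)). lra. }
  rewrite <- E at 1. rewrite <- F2_double_sin by lra.
  apply (sin_pq_Fpq 2 q Rlt_0_2 q_gt0 _ F2_limit). split.
  - now apply double_sin_ge0.
  - destruct Hu' as [H|H].
    + apply Rlt_le, double_sin_lt1. lra.
    + change (double_sin (S x) <= 1). rewrite H, double_sin_mid. lra.
Qed.

(** Both sides change sign under [x |-> x + quarter] and are odd, so the quarter period of
    [s] suffices. *)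
Lemma sin_2q_double (x : R) : s (k * x) = k * (S x * cosine x).
Proof.
  assert (Hl := quarter_gt0). revert x.
  apply (periodic_ind _ (- F (fermat_mid q)) quarter); [lra| |].
  - intros x. rewrite cosine_add_quarter.
    replace (k * (x + quarter)) with (k * x + 2 * (k * F (fermat_mid q)))
      by (unfold quarter; ring).
    rewrite (sin_pq_antiperiodic 2 q Rlt_0_2 q_gt0 _ F2_limit).
    change (S (x + quarter)) with (cosine x).
    split; intros H; nra.
  - unfold quarter in *. intros x Hx. destruct (Rle_lt_dec 0 x) as [H|H].
    + apply sin_2q_double_quarter. lra.
    + rewrite <- (Ropp_involutive x). rewrite cosine_even, sin_conj_odd, Ropp_mult_distr_r_reverse.
      rewrite (sin_pq_odd 2 q Rlt_0_2 q_gt0 _ F2_limit), sin_2q_double_quarter by lra. ring.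
Qed.

Lemma over_id_double (x : R) : over_id s (k * x) = over_id S x * cosine x.
Proof.
  assert (Hk := double_factor_gt0). unfold over_id.
  destruct (Req_dec_T x 0) as [->|Hx].
  - rewrite Rmult_0_r. destruct (Req_dec_T 0 0); [|lra]. rewrite cosine_0. ring.
  - destruct (Req_dec_T (k * x) 0) as [H|H].
    + apply Rmult_integral in H. lra.
    + rewrite sin_2q_double. field. lra.
Qed.

Lemma over_id_sin_conj_continuous (x : R) : continuous (over_id S) x.
Proof.
  apply continuous_over_id.
  - exact sin_conj_0.
  - eapply is_derive_eq; [apply derive_sin_conj|].
    rewrite cosine_0, spow_nonneg by lra. apply rpow_base1.
  - exact sin_conj_continuous.
Qed.

Lemma over_id_sin_2q_continuous (y : R) : continuous (over_id s) y.
Proof.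
  assert (Hk := double_factor_gt0).
  apply continuous_ext with (fun y => over_id S (/ k * y) * cosine (/ k * y)).
  { intros z. rewrite <- over_id_double. f_equal. field. lra. }
  assert (Hlin : continuous (fun y => / k * y) y).
  { apply (continuous_mult (fun _ => / k) (fun y => y));
      [apply continuous_const|apply continuous_id]. }
  apply (continuous_mult (fun y => over_id S (/ k * y)) (fun y => cosine (/ k * y))).
  - apply (continuous_comp (fun y => / k * y) (over_id S));
      [exact Hlin|apply over_id_sin_conj_continuous].
  - apply (continuous_comp (fun y => / k * y) cosine); [exact Hlin|apply cosine_continuous].
Qed.

(** * Integration by parts and convergence *)

Definition rhs_integrand (y : R) : R := spow (over_id s y) (q - 1).

Definition lhs_integrand (x : R) : R := rpow (Rabs (over_id S x)) q.

Notation f := lhs_integrand.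
Notation g := rhs_integrand.

Lemma lhs_continuous (x : R) : continuous f x.
Proof.
  apply (continuous_comp (over_id S) (fun v => rpow (Rabs v) q)).
  - apply over_id_sin_conj_continuous.
  - apply continuous_rpow_abs, q_gt0.
Qed.

Lemma rhs_continuous (y : R) : continuous g y.
Proof.
  apply (continuous_comp (over_id s) (fun v => spow v (q - 1))).
  - apply over_id_sin_2q_continuous.
  - apply continuous_spow. lra.
Qed.

Lemma lhs_pos (x : R) : 0 < x -> f x = rpow (Rabs (S x)) q * rpow x (- q).
Proof.
  intros Hx. unfold lhs_integrand, over_id. destruct (Req_dec_T x 0) as [H|_]; [lra|].
  unfold Rdiv. assert (Hi := Rinv_0_lt_compat x Hx).
  rewrite Rabs_mult, (Rabs_right (/ x)), rpow_mult_base by (try apply Rabs_pos; lra).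
  now rewrite rpow_Rinv.
Qed.

Lemma rhs_double_pos (x : R) :
  0 < x ->
  g (k * x) = spow (S x) (q - 1) * spow (cosine x) (q - 1) * rpow x (1 - q).
Proof.
  intros Hx. unfold rhs_integrand. rewrite over_id_double.
  unfold over_id. destruct (Req_dec_T x 0) as [H|_]; [lra|].
  unfold Rdiv. assert (Hi := Rinv_0_lt_compat x Hx).
  rewrite !spow_mult, (spow_nonneg (/ x)), rpow_Rinv by lra.
  replace (- (q - 1)) with (1 - q) by ring. ring.
Qed.

(** For [x > 0] the function is [|S x| ^ q x ^ (1 - q)]; the chain rule on the first factor
    gives the product [spow (S x) (q - 1) * spow (cosine x) (q - 1)], in which the double-angle
    formula recognises [g]. *)
Lemma derive_boundary_term (x : R) :
  0 < x ->
  is_derive (fun x => x * f x) x (q * g (k * x) - (q - 1) * f x).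
Proof.
  intros Hx.
  assert (Heq : forall y, 0 < y -> rpow (Rabs (S y)) q * rpow y (1 - q) = y * f y).
  { intros y Hy. rewrite lhs_pos by exact Hy.
    rewrite (rpow_pred y (1 - q)). replace (1 - q - 1) with (- q) by ring. ring. }
  apply is_derive_ext_loc with (fun x => rpow (Rabs (S x)) q * rpow x (1 - q)).
  - exists (mkposreal x Hx). intros y Hy. change (Rabs (y - x) < x) in Hy.
    apply Rabs_def2 in Hy. apply Heq. lra.
  - eapply is_derive_eq.
    + apply derive_mult.
      * apply (derive_comp (fun v => rpow (Rabs v) q) S); [now apply derive_rpow_abs|].
        apply derive_sin_conj.
      * now apply derive_rpow_pos.
    + rewrite lhs_pos, rhs_double_pos by assumption.
      replace (1 - q - 1) with (- q) by ring. ring.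
Qed.

(** Integration by parts, [x ^ (1 - q) / (1 - q)] being the primitive of [x ^ (- q)], followed
    by the substitution [y = k x]. Both are expressed by the vanishing of the derivative of
    [D] on [(0, M)]; the singular end [0] is absorbed by the continuity of [D] there. *)
Lemma integration_by_parts (M : R) :
  0 < M ->
  RInt f 0 M = conj_exp q / k * RInt g 0 (k * M) - / (q - 1) * (M * f M).
Proof.
  intros HM. assert (Hk := double_factor_gt0).
  assert (Hlin : forall x, is_derive (fun x => k * x) x k).
  { intros x. auto_derive; [exact I|ring]. }
  assert (HG : forall x, is_derive (fun x => RInt g 0 (k * x)) x (g (k * x) * k)).
  { intros x. apply (derive_comp (fun y => RInt g 0 y) (fun x => k * x)); [|apply Hlin].
    apply derive_RInt, rhs_continuous. }
  pose (D := fun x =>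
    RInt f 0 x - conj_exp q / k * RInt g 0 (k * x) + / (q - 1) * (x * f x)).
  destruct (MVT_gen D 0 M (fun _ => 0)) as [c [_ E]].
  - rewrite Rmin_left, Rmax_right by lra. intros x Hx. unfold D. eapply is_derive_eq.
    + apply derive_plus; [apply derive_minus|].
      * apply derive_RInt, lhs_continuous.
      * apply is_derive_scal, HG.
      * apply (is_derive_scal (fun x => x * f x)). now apply derive_boundary_term.
    + unfold conj_exp. field. lra.
  - intros x _. apply continuity_pt_filterlim. unfold D.
    apply (continuous_plus (fun x => RInt f 0 x - conj_exp q / k * RInt g 0 (k * x))
             (fun x => / (q - 1) * (x * f x))).
    + eapply is_derive_continuous, derive_minus.
      * apply derive_RInt, lhs_continuous.
      * apply is_derive_scal, HG.
    + apply (continuous_mult (fun _ => / (q - 1)) (fun x => x * f x)).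
      * apply continuous_const.
      * apply (continuous_mult (fun x => x) f); [apply continuous_id|apply lhs_continuous].
  - assert (E0 : D 0 = 0).
    { unfold D. rewrite !Rmult_0_r, !RInt_point.
      change (@zero R_CompleteNormedModule) with 0. ring. }
    unfold D in E at 1. lra.
Qed.

Lemma lhs_decay (x : R) : 0 < x -> f x <= rpow x (- q).
Proof.
  intros Hx. rewrite lhs_pos by assumption.
  assert (H := rpow_le1 _ q q_gt0 (sin_conj_abs_le1 x)).
  rewrite <- (Rmult_1_l (rpow x (- q))) at 2.
  apply Rmult_le_compat_r; [apply rpow_ge0|exact H].
Qed.

Lemma boundary_term_lim : filterlim (fun x => x * f x) (Rbar_locally p_infty) (locally 0).
Proof.
  apply filterlim_locally. intros eps.
  destruct (proj1 (filterlim_locally (F := Rbar_locally p_infty) _ _)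
    (rpow_neg_lim (1 - q) ltac:(lra)) eps) as [A HA].
  exists (Rmax A 0). intros x Hx.
  assert (Hx0 : 0 < x) by (apply Rle_lt_trans with (2 := Hx), Rmax_r).
  assert (HxA : A < x) by (apply Rle_lt_trans with (2 := Hx), Rmax_l).
  specialize (HA x HxA). change (Rabs (rpow x (1 - q) - 0) < eps) in HA.
  change (Rabs (x * f x - 0) < eps). rewrite Rminus_0_r in *.
  apply Rle_lt_trans with (2 := HA).
  assert (H := lhs_decay x Hx0). assert (H' := rpow_ge0 (Rabs (over_id S x)) q).
  fold (f x) in H'. rewrite !Rabs_right.
  - rewrite (rpow_pred x (1 - q)). replace (1 - q - 1) with (- q) by ring.
    apply Rmult_le_compat_l; lra.
  - apply Rle_ge, rpow_ge0.
  - apply Rle_ge, Rmult_le_pos; lra.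
Qed.

(** Comparison with [x ^ (- q)] on [[1, oo)], through the monotonicity of
    [RInt f 0 x + x ^ (1 - q) / (q - 1)]. *)
Lemma lhs_integral_bounded : exists B, forall M, 0 <= M -> RInt f 0 M <= B.
Proof.
  assert (Hd : forall x, is_derive (fun x => RInt f 0 x) x (f x)).
  { intros x. apply derive_RInt, lhs_continuous. }
  assert (Hq : 0 < / (q - 1)) by (apply Rinv_0_lt_compat; lra).
  exists (RInt f 0 1 + / (q - 1)).
  assert (H1 : forall M, 1 <= M -> RInt f 0 M <= RInt f 0 1 + / (q - 1)).
  { intros M HM.
    assert (HD : forall x, 1 <= x <= M -> is_derive
      (fun x => RInt f 0 x + / (q - 1) * rpow x (1 - q)) x (f x - rpow x (- q))).
    { intros x Hx. eapply is_derive_eq.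
      - apply derive_plus; [apply Hd|]. apply (is_derive_scal (fun x => rpow x (1 - q))).
        apply derive_rpow_pos. lra.
      - replace (1 - q - 1) with (- q) by ring. field. lra. }
    destruct (MVT_gen (fun x => RInt f 0 x + / (q - 1) * rpow x (1 - q)) 1 M
      (fun x => f x - rpow x (- q))) as [c [Hc E]].
    - rewrite Rmin_left, Rmax_right by lra. intros x Hx. apply HD. lra.
    - rewrite Rmin_left, Rmax_right by lra. intros x Hx. apply continuity_pt_filterlim.
      exact (is_derive_continuous _ x _ (HD x Hx)).
    - rewrite Rmin_left, Rmax_right in Hc by lra. cbv beta in E.
      rewrite rpow_base1 in E. assert (H := lhs_decay c ltac:(lra)).
      assert (H' := Rmult_le_pos _ _ (Rlt_le _ _ Hq) (rpow_ge0 M (1 - q))).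
      assert (H2 : (rpow c (- q) - f c) * (M - 1) >= 0).
      { apply Rle_ge, Rmult_le_pos; lra. }
      lra. }
  intros M HM. apply Rle_trans with (RInt f 0 (Rmax M 1)).
  - apply RInt_nonneg_incr; [apply lhs_continuous|intros; apply rpow_ge0|apply Rmax_l].
  - apply H1, Rmax_r.
Qed.

(** The integral of [g] inherits its convergence from that of [f] through
    [integration_by_parts]. *)
Lemma lhs_rhs_limits : exists L : R,
  filterlim (fun M => RInt f 0 M) (Rbar_locally p_infty) (locally (conj_exp q / k * L)) /\
  filterlim (fun M => RInt g 0 M) (Rbar_locally p_infty) (locally L).
Proof.
  assert (Hk := double_factor_gt0). assert (Hc := conj_gt0).
  destruct lhs_integral_bounded as [B HB].
  destruct (monotone_limit (fun M => RInt f 0 M) B) as [L HL].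
  - intros x y Hxy. apply RInt_nonneg_incr; [apply lhs_continuous|intros; apply rpow_ge0|lra].
  - exact HB.
  - exists (k / conj_exp q * L).
    replace (conj_exp q / k * (k / conj_exp q * L)) with L by (field; lra).
    split; [exact HL|].
    assert (HG : is_lim (fun M => k / conj_exp q * (RInt f 0 M + / (q - 1) * (M * f M)))
                   p_infty (k / conj_exp q * L)).
    { apply (is_lim_scal_l _ (k / conj_exp q) p_infty L).
      replace (Finite L) with (Finite (L + / (q - 1) * 0)) by (f_equal; ring).
      apply (is_lim_plus' _ _ p_infty L (/ (q - 1) * 0)); [exact HL|].
      apply (is_lim_scal_l (fun M => M * f M) (/ (q - 1)) p_infty 0).
      exact boundary_term_lim. }
    apply filterlim_ext_loc with
      (fun N => k / conj_exp q * (RInt f 0 (N / k) + / (q - 1) * (N / k * f (N / k)))).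
    + exists 0. intros N HN. rewrite integration_by_parts by (now apply Rdiv_lt_0_compat).
      replace (k * (N / k)) with N by (field; lra). field. lra.
    + apply (filterlim_comp _ _ _ (fun N => N / k)
        (fun M => k / conj_exp q * (RInt f 0 M + / (q - 1) * (M * f M)))
        _ (Rbar_locally p_infty)); [|exact HG].
      intros P [A HA]. exists (k * A). intros N HN. apply HA.
      apply Rmult_lt_reg_l with k; [exact Hk|].
      replace (k * (N / k)) with N by (field; lra). exact HN.
Qed.

Lemma conjugate_integrals_eq : integrals_eq f (conj_exp q / k) g.
Proof.
  destruct lhs_rhs_limits as [L [Hf Hg]].
  apply integrals_eq_of_limits with (conj_exp q / k * L) L; try assumption.
  - exact lhs_continuous.
  - exact rhs_continuous.
  - reflexivity.
Qed.

End conjugate.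

(** * The circular case *)

(** [F_{2,2}] is the arcsine: the derivative of [F_{2,2} (sin t)] is [cos t / sqrt (cos t ^ 2)]. *)
Lemma F22_sin (t : R) : 0 <= t < PI / 2 -> Fpq 2 2 (sin t) = t.
Proof.
  assert (Hlt : forall t, 0 <= t < PI / 2 -> sin t < 1).
  { intros u Hu. rewrite <- sin_PI2. apply sin_increasing_1; lra. }
  assert (Hd : forall t, 0 <= t < PI / 2 ->
    is_derive (fun t => Fpq 2 2 (sin t) - t) t 0).
  { intros u Hu. assert (Hs : 0 <= sin u) by (apply sin_ge_0; lra).
    assert (Hc : 0 < cos u) by (apply cos_gt_0; lra). eapply is_derive_eq.
    - apply (derive_minus (fun t => Fpq 2 2 (sin t)) (fun t => t)).
      + apply (derive_comp (Fpq 2 2) sin); [|apply is_derive_sin].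
        apply derive_Fpq; [lra|now apply Hlt].
      + apply (is_derive_id (K := R_AbsRing)).
    - change (@one R_AbsRing) with 1. unfold F_integrand.
      assert (E2 : rpow (sin u) 2 = sin u ^ 2) by (apply (rpow_INR _ 2); [lia|exact Hs]).
      assert (E : 1 - sin u ^ 2 = cos u * cos u)
        by (assert (H := sin2_cos2 u); unfold Rsqr in H; simpl; lra).
      rewrite E2, E, rpow_mult_base, <- rpow_plus by lra.
      replace (- / 2 + - / 2) with (- (1)) by field.
      rewrite rpow_pos, Rpower_Ropp, Rpower_1 by lra. field. lra. }
  intros [[Ht|<-] Ht1]; [|now rewrite sin_0, Fpq_0].
  apply Rminus_diag_uniq. transitivity (Fpq 2 2 (sin 0) - 0).
  - symmetry. apply (eq_is_derive (fun t => Fpq 2 2 (sin t) - t)); [|exact Ht].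
    intros u Hu. apply Hd. lra.
  - rewrite sin_0, Fpq_0. ring.
Qed.

Lemma F22_limit : filterlim (Fpq 2 2) (at_left 1) (locally (PI / 2)).
Proof.
  assert (Hp := PI2_RGT_0).
  assert (Hnear : at_left (PI / 2) (fun t => 0 <= t < PI / 2)).
  { exists (mkposreal _ Hp). intros t Ht Ht1.
    change (Rabs (t - PI / 2) < PI / 2) in Ht. apply Rabs_def2 in Ht. lra. }
  apply (F_limit_along 2 2 Rlt_0_2 Rlt_0_2 (at_left (PI / 2)) sin).
  - apply at_left_proper_filter.
  - generalize Hnear. apply filter_imp. intros t Ht.
    rewrite <- sin_PI2. apply sin_increasing_1; lra.
  - apply (filterlim_filter_le_1 (F := locally (PI / 2))); [apply filter_le_within|].
    rewrite <- sin_PI2. apply continuous_sin.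
  - apply filterlim_ext_loc with (fun t => t).
    + generalize Hnear. apply filter_imp. intros t Ht. symmetry. now apply F22_sin.
    + apply filter_le_within.
Qed.

Lemma sin_22 (x : R) : sin_pq 2 2 x = sin x.
Proof.
  assert (Hp := PI2_RGT_0).
  assert (Hpos : forall x, 0 <= x <= PI / 2 -> sin_pq 2 2 x = sin x).
  { intros t [Ht0 [Ht| ->]].
    - rewrite <- (F22_sin t) at 1 by lra.
      apply (sin_pq_Fpq 2 2 Rlt_0_2 Rlt_0_2 _ F22_limit). split.
      + apply sin_ge_0; lra.
      + apply SIN_bound.
    - rewrite sin_PI2. exact (sin_pq_1 2 2 Rlt_0_2 Rlt_0_2 _ F22_limit). }
  revert x. apply (periodic_ind _ (- (PI / 2)) PI); [lra| |].
  - intros x. replace PI with (2 * (PI / 2)) at 1 by field.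
    rewrite (sin_pq_antiperiodic 2 2 Rlt_0_2 Rlt_0_2 _ F22_limit), neg_sin.
    split; intros H; lra.
  - intros x Hx. destruct (Rle_lt_dec 0 x) as [H|H].
    + apply Hpos. lra.
    + rewrite <- (Ropp_involutive x), sin_neg.
      rewrite (sin_pq_odd 2 2 Rlt_0_2 Rlt_0_2 _ F22_limit), Hpos by lra. reflexivity.
Qed.

(** * The theorem *)

Lemma rpow_abs_even (u : R) (n : nat) :
  Nat.Even n -> (0 < n)%nat -> rpow (Rabs u) (INR n) = u ^ n.
Proof.
  intros [m ->] Hn. rewrite rpow_INR by (assumption || apply Rabs_pos).
  now rewrite !pow_mult, pow2_abs.
Qed.

(** The case [n = 2] is separate: [rpow 0 0 = 0], while [u ^ (n - 2) = 1] for [u = 0]. *)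
Lemma rpow_abs_even_mult (u : R) (n : nat) :
  Nat.Even n -> (2 <= n)%nat -> rpow (Rabs u) (INR n - 2) * u = u ^ (n - 1).
Proof.
  intros [m E] Hn. replace (INR n - 2) with (INR (n - 2))
    by (rewrite minus_INR; [reflexivity|exact Hn]).
  destruct (Nat.eq_dec n 2) as [->|Hn2].
  - simpl. destruct (Req_dec u 0) as [->|Hu]; [ring|].
    rewrite rpow_pos, Rpower_O by now apply Rabs_pos_lt. ring.
  - rewrite rpow_abs_even; [|exists (m - 1)%nat; lia|lia].
    replace (n - 1)%nat with (S (n - 2)) by lia. simpl. ring.
Qed.

Theorem theorem1p2 :
  (forall q : R, 1 < q ->
     integrals_eq
       (fun x => rpow (Rabs (over_id (sin_pq (conj_exp q) q) x)) q)
       (conj_exp q / Rpower 2 (2 / q))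
       (fun x => rpow (Rabs (over_id (sin_pq 2 q) x)) (q - 2)
                 * over_id (sin_pq 2 q) x))
  /\
  (forall n : nat, Nat.Even n -> 1 < INR n ->
     integrals_eq
       (fun x => over_id (sin_pq (conj_exp (INR n)) (INR n)) x ^ n)
       (conj_exp (INR n) / Rpower 2 (2 / INR n))
       (fun x => over_id (sin_pq 2 (INR n)) x ^ (n - 1)))
  /\
  integrals_eq (fun x => over_id sin x ^ 2) 1 (fun x => over_id sin x).
Proof.
  assert (H1 : forall q : R, 1 < q ->
     integrals_eq
       (fun x => rpow (Rabs (over_id (sin_pq (conj_exp q) q) x)) q)
       (conj_exp q / Rpower 2 (2 / q))
       (fun x => rpow (Rabs (over_id (sin_pq 2 q) x)) (q - 2)
                 * over_id (sin_pq 2 q) x)).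
  { intros q Hq. replace (fun x => rpow (Rabs (over_id (sin_pq 2 q) x)) (q - 2)
                 * over_id (sin_pq 2 q) x) with (rhs_integrand q).
    - exact (conjugate_integrals_eq q Hq).
    - apply functional_extensionality. intros x. unfold rhs_integrand, spow.
      now replace (q - 1 - 1) with (q - 2) by ring. }
  assert (H2 : forall n : nat, Nat.Even n -> 1 < INR n ->
     integrals_eq
       (fun x => over_id (sin_pq (conj_exp (INR n)) (INR n)) x ^ n)
       (conj_exp (INR n) / Rpower 2 (2 / INR n))
       (fun x => over_id (sin_pq 2 (INR n)) x ^ (n - 1))).
  { intros n He Hn. assert (Hn2 : (1 < n)%nat) by (apply INR_lt; exact Hn).
    replace (fun x => over_id (sin_pq (conj_exp (INR n)) (INR n)) x ^ n)
      with (fun x => rpow (Rabs (over_id (sin_pq (conj_exp (INR n)) (INR n)) x)) (INR n))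
      by (apply functional_extensionality; intros x; apply rpow_abs_even; [exact He|lia]).
    replace (fun x => over_id (sin_pq 2 (INR n)) x ^ (n - 1))
      with (fun x => rpow (Rabs (over_id (sin_pq 2 (INR n)) x)) (INR n - 2)
                 * over_id (sin_pq 2 (INR n)) x)
      by (apply functional_extensionality; intros x; apply rpow_abs_even_mult; [exact He|lia]).
    now apply H1. }
  split; [exact H1|split; [exact H2|]].
  assert (Hsin : sin_pq 2 2 = sin) by (apply functional_extensionality, sin_22).
  assert (Hconj : conj_exp 2 = 2) by (unfold conj_exp; field).
  assert (H := H2 2%nat ltac:(now exists 1%nat) ltac:(simpl; lra)).
  change (INR 2) with 2 in H. rewrite Hconj, Hsin in H.
  replace (2 / Rpower 2 (2 / 2)) with 1 in H
    by (replace (2 / 2) with 1 by field; rewrite Rpower_1 by lra; field).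
  replace (fun x => over_id sin x) with (fun x => over_id sin x ^ (2 - 1)).
  - exact H.
  - apply functional_extensionality. intros x. apply pow_1.
Qed.
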